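(* For the elephant random walk with two memory channels and memory parameter $p$, for every $0<p\le7/8$, $$\frac{S_n}{n}\longrightarrow0,\qquad \frac{A_n}{n}\longrightarrow\frac23\quad\text{almost surely}.$$ In particular, at $p=7/8$ the walk has zero asymptotic velocity, and asymptotically two-thirds of its increments are nonzero.
   Context: Model (elephant random walk with two memory channels, memory parameter $p\in(0,1)$): $S_0=0$; $X_1,X_2$ are independent random signs, each equal to $1$ or $-1$ with probability $1/2$. For $n\ge2$ choose, independently of the past and independently for different $n$, indices $U_{1,n+1},U_{2,n+1}$ i.i.d. uniform on $\{1,\ldots,n\}$ and signs $\sigma_{1,n+1},\sigma_{2,n+1}\in\{-1,1\}$, independent of each other and of the indices, with $\mathbb{P}(\sigma_{i,n+1}=1)=p$, $\mathbb{P}(\sigma_{i,n+1}=-1)=1-p$. Put $Y_{i,n+1}=\sigma_{i,n+1}X_{U_{i,n+1}}$ for $i=1,2$, and $X_{n+1}=\operatorname{sgn}(Y_{1,n+1}+Y_{2,n+1})$ with $\operatorname{sgn}(0)=0$. The position is $S_n=\sum_{j=1}^nX_j$ and $A_n=\sum_{j=1}^n\mathbf{1}_{\{X_j\ne0\}}$ is the number of nonzero steps up to time $n$. *)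

(* Defs.v *)
From HB Require Import structures.
From mathcomp Require Import all_boot all_order all_algebra.
From mathcomp Require Import finmap.
From mathcomp Require Import all_classical all_reals all_analysis.
Import Order.TTheory GRing.Theory Num.Theory.
Import numFieldNormedType.Exports.

Set Implicit Arguments.
Unset Strict Implicit.
Unset Printing Implicit Defensive.

Local Open Scope classical_set_scope.
Local Open Scope ring_scope.

(* Mutual independence of the set systems F i, i in I: the product rule for
   every finite subfamily. *)
Definition mutual_independence d (T : measurableType d) (R : realType)
    (P : probability T R) (I0 : choiceType) (I : set I0)
    (F : I0 -> set (set T)) : Prop :=
  forall J : {fset I0}, [set` J] `<=` I ->
  forall E : I0 -> set T, (forall i, i \in J -> F i (E i)) ->
    P (\bigcap_(i in [set` J]) E i) = (\prod_(i <- J) P (E i))%E.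

(* Names of the independent primitive variables: X_n, U_{i,n} and sigma_{i,n};
   the channels 1, 2 are the two elements of 'I_2. *)
Inductive source :=
  | SrcStep of nat
  | SrcIndex of 'I_2 & nat
  | SrcSign of 'I_2 & nat.

Definition source_encode (s : source) : nat + ('I_2 * nat + 'I_2 * nat) :=
  match s with
  | SrcStep n => inl n
  | SrcIndex i n => inr (inl (i, n))
  | SrcSign i n => inr (inr (i, n))
  end.

Definition source_decode (t : nat + ('I_2 * nat + 'I_2 * nat)) : source :=
  match t with
  | inl n => SrcStep n
  | inr (inl (i, n)) => SrcIndex i n
  | inr (inr (i, n)) => SrcSign i n
  end.

Lemma source_encodeK : cancel source_encode source_decode.
Proof. by case. Qed.

HB.instance Definition _ := Equality.copy source (can_type source_encodeK).
HB.instance Definition _ := CanHasChoice source_encodeK.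

(* Only X_1, X_2 are primitive steps, and the channels are used from time 3. *)
Definition primitive_source : set source :=
  [set s | match s with
           | SrcStep n => (1 <= n <= 2)%N
           | SrcIndex _ n => (3 <= n)%N
           | SrcSign _ n => (3 <= n)%N
           end].

Section ElephantWalk.
Context d (T : measurableType d) (R : realType) (P : probability T R).

Definition source_events (X : nat -> {RV P >-> R})
    (U : 'I_2 -> nat -> {RV P >-> nat}) (sigma : 'I_2 -> nat -> {RV P >-> R})
    (s : source) : set (set T) :=
  match s with
  | SrcStep n => preimage_set_system setT (X n) measurable
  | SrcIndex i n => preimage_set_system setT (U i n) measurable
  | SrcSign i n => preimage_set_system setT (sigma i n) measurable
  end.

(* Y_{i,n} = sigma_{i,n} X_{U_{i,n}} *)
Definition recalled_step (X : nat -> {RV P >-> R})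
    (U : 'I_2 -> nat -> {RV P >-> nat}) (sigma : 'I_2 -> nat -> {RV P >-> R})
    (i : 'I_2) (n : nat) (w : T) : R :=
  sigma i n w * X (U i n w) w.

(* Steps are numbered from 1: the value X 0, and the values of U i n and
   sigma i n for n <= 2, are unconstrained. *)
Record elephant_walk (p : R) (X : nat -> {RV P >-> R})
    (U : 'I_2 -> nat -> {RV P >-> nat})
    (sigma : 'I_2 -> nat -> {RV P >-> R}) : Prop := ElephantWalk {
  first_steps_law : forall n, (1 <= n <= 2)%N ->
    P [set w | X n w = 1] = (2^-1)%:E /\ P [set w | X n w = -1] = (2^-1)%:E;
  index_law : forall i n, (2 <= n)%N -> forall k, (1 <= k <= n)%N ->
    P [set w | U i n.+1 w = k] = (n%:R^-1)%:E;
  sign_law : forall i n, (2 <= n)%N ->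
    P [set w | sigma i n.+1 w = 1] = p%:E /\
    P [set w | sigma i n.+1 w = -1] = (1 - p)%:E;
  sources_independent :
    mutual_independence P primitive_source (source_events X U sigma);
  step_recursion : forall n, (2 <= n)%N -> forall w,
    X n.+1 w = Num.sg (\sum_(i < 2) recalled_step X U sigma i n.+1 w)
}.

Definition position (X : nat -> {RV P >-> R}) (n : nat) (w : T) : R :=
  \sum_(1 <= j < n.+1) X j w.

Definition nonzero_steps (X : nat -> {RV P >-> R}) (n : nat) (w : T) : nat :=
  (\sum_(1 <= j < n.+1) (X j w != 0%R))%N.

End ElephantWalk.

(* Main.v *)
Require Import Defs.
From mathcomp Require Import all_boot all_order all_algebra.
From mathcomp Require Import finmap ring lra zify.
From mathcomp Require Import all_classical all_reals all_analysis.
Import Order.TTheory GRing.Theory Num.Theory.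
Import numFieldNormedType.Exports.

Set Implicit Arguments.
Unset Strict Implicit.
Unset Printing Implicit Defensive.

Local Open Scope classical_set_scope.
Local Open Scope ring_scope.

(** Write m = 2p - 1, x_n = S_n / n and a_n = A_n / n.  For y, z in {-1, 0, 1},
    sgn (y + z) = y + z - (y z^2 + y^2 z) / 2, and its square is
    y^2 + z^2 - (3/2) y^2 z^2 + y z / 2.  Given the past, the two recalled steps
    are independent with mean m x_n and second moment a_n, so the next step has
    conditional mean m x_n (2 - a_n) and is nonzero with conditional probability
    2 a_n - (3/2) a_n^2 + m^2 x_n^2 / 2 ([next_mean_id], [next_mean_nonzero]).
    Hence (x_n, a_n) follows, in the time scale log n and up to noise, the flow
      x' = x (m (2 - a) - 1),   a' = - (3/2) a (a - 2/3) + m^2 x^2 / 2,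
    and the theorem says that this flow drives the walk to (0, 2/3).

    The noise.  The centred increments are orthogonal and bounded, so their sum
    up to time n has second moment at most n ([path_mean_noise]); Borel-Cantelli
    along the fourth powers and the boundedness of the increments make it o(n)
    almost surely ([ae_noise_le], [sublinear_of_fourth_powers]).  Subtracting it
    from S_n and A_n leaves sequences y_n, b_n close to x_n, a_n which obey the
    Euler scheme of the flow exactly, with steps 1 / (n + 1).

    The flow.  The rest point a = 0 is unstable, but noise that is merely o(n)
    could hold a deterministic path there.  It is excluded by probability: while
    a < 1/3 the expectation of 1 / (A - 1) shrinks by the factor 1 - 3 / (2n) at
    each step, hence faster than 1 / n, although 1 / (A - 1) >= 1 / n; so the walk
    cannot stay in that region ([ae_activity_recurrent]).  From a time with
    a >= 1/3 the second equation brings the lower limit of a up to 2/3.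
    The condition p <= 7/8 means m <= 3/4, and then
    m (2 - a) - 1 <= - (3/4) (a - 2/3).  At p = 7/8 the linear part of the first
    equation vanishes at (0, 2/3); what still damps x is that the term
    m^2 x^2 / 2 pushes a above 2/3.  The function x^2 (8/3 - a) captures this: it
    decreases at a rate of order x^4 for all p <= 7/8, up to an error proportional
    to the defect of a below 2/3 ([lyapunov_rate_le]).  So
    x -> 0, and the second equation then gives a -> 2/3.

    The conditional laws.  Only upper bounds of probabilities are needed, and
    these follow from independence of the sources without conditional
    expectations: an event about the first n steps is covered by a finite union of
    cylinders whose interaction with all later sources is bounded
    ([path_event_decoupled]).  Its probability is then at most [path_mean], an
    explicit finite average over paths in which the moments are computed. *)

(** * Sequences driven by a drift of order 1 / n *)

Lemma harmonic_tail_unbounded (R : realType) (N : nat) (K : R) :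
  exists2 n, (N <= n)%N & K <= \sum_(N <= k < n) k.+1%:R^-1.
Proof.
apply: contrapT => H.
apply: (@dvg_harmonic R); apply: nondecreasing_is_cvgn.
  by apply: nondecreasing_series => n _ _; exact: harmonic_ge0.
exists (\sum_(0 <= k < N) k.+1%:R^-1 + K) => _ [n _ <-].
have nonneg k : (0 : R) <= k.+1%:R^-1 by rewrite invr_ge0.
rewrite /series /harmonic /=.
have [nN|Nn] := leqP N n.
  rewrite (big_cat_nat (n := N)) //= lerD2l leNgt; apply/negP => Kn.
  by apply: H; exists n => //; exact: ltW.
rewrite [X in _ <= X + _](big_cat_nat (n := n)) //=; last exact: ltnW.
rewrite -addrA lerDl addr_ge0 ?sumr_ge0 //.
rewrite leNgt; apply/negP => K0; apply: H; exists N => //.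
by rewrite big_geq // ltW.
Qed.

Lemma harmonic_eventually_small (R : realType) (C r : R) :
  0 < r -> \forall n \near \oo, C / n.+1%:R <= r.
Proof.
have := cvgMl_tmp (a := C) (@cvg_harmonic R); rewrite mulr0 => H r0.
exact: (cvgr_le _ (H _) _ r0).
Qed.

(** Under drift -c / (n + 1) above level e, the sequence lies below
    max (2e, B - c H_n) with H_n a tail of the harmonic series, which diverges.
    The drift is only assumed below B, because near the unstable rest point of
    the flow it fails; one late visit below B is enough to start the descent. *)
Lemma drift_limsup_le0 (R : realType) (u : nat -> R) (B C : R) :
  0 < B -> 0 < C ->
  (forall e : R, 0 < e -> exists2 c, 0 < c &
     \forall n \near \oo, e <= u n <= B -> u n.+1 <= u n - c / n.+1%:R) ->
  (\forall n \near \oo, u n.+1 <= u n + C / n.+1%:R) ->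
  (forall N, exists2 n, (N <= n)%N & u n <= B) ->
  forall e : R, 0 < e -> \forall n \near \oo, u n <= e.
Proof.
move=> B0 C0 Hdec [N1 _ HC] Hfreq e e0.
(* Both r + r <= e and r + r <= B are used: a step from below r may overshoot to 2r. *)
pose r := Num.min e B / 2.
have r0 : 0 < r by rewrite divr_gt0 // lt_min e0.
have re : r + r <= e by rewrite -splitr ge_min lexx.
have rB : r + r <= B by rewrite -splitr ge_min lexx orbT.
have [c c0 [N2 _ Hc]] := Hdec r r0.
have [N3 _ HN3] : \forall n \near \oo, C / n.+1%:R <= r.
  by have := harmonic_eventually_small C r0.
have [n0 n0N un0] := Hfreq (N1 + N2 + N3)%N.
have key n : (n0 <= n)%N ->
    u n <= Num.max (r + r) (B - c * \sum_(n0 <= k < n) k.+1%:R^-1).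
  elim: n => [|n IH].
    by rewrite leqn0 => /eqP n00; rewrite n00 big_geq // in un0 *; rewrite mulr0 subr0 le_max un0 orbT.
  rewrite leq_eqVlt => /predU1P[<-|].
    by rewrite big_geq // mulr0 subr0 le_max un0 orbT.
  rewrite ltnS => n0n; move/(_ n0n) in IH.
  have nN1 : (N1 <= n)%N.
    by rewrite (leq_trans _ n0n) // (leq_trans _ n0N) // -addnA leq_addr.
  have nN2 : (N2 <= n)%N.
    by rewrite (leq_trans _ n0n) // (leq_trans _ n0N) // addnAC leq_addl.
  have nN3 : (N3 <= n)%N.
    by rewrite (leq_trans _ n0n) // (leq_trans _ n0N) // leq_addl.
  have [ur|ru] := leP (u n) r.
    rewrite le_max; apply/orP; left; apply: le_trans (HC n nN1) _.
    by rewrite lerD // HN3.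
  have inv0 : 0 < n.+1%:R^-1 :> R by rewrite invr_gt0.
  have uB : u n <= B.
    apply: le_trans IH _; rewrite ge_max rB /= gerBl mulr_ge0 ?(ltW c0) //.
    by rewrite sumr_ge0 // => k _; rewrite invr_ge0.
  have := Hc n nN2; rewrite (ltW ru) uB => /(_ isT) H.
  rewrite big_nat_recr //= mulrDr.
  move: IH; rewrite !le_max => /orP[IH|IH]; apply/orP; [left|right].
    by apply: le_trans H _; rewrite lerBlDr (le_trans IH) // lerDl mulr_ge0 // ltW.
  by apply: le_trans H _; rewrite opprD addrA lerB.
have [n1 n01 Hn1] := harmonic_tail_unbounded n0 (B / c).
exists (n1)%N => // n /= n1n.
apply: le_trans (key n (leq_trans n01 n1n)) _.
rewrite ge_max re /=; apply: (@le_trans _ _ 0); last exact: ltW.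
rewrite subr_le0 mulrC -ler_pdivrMr //; apply: le_trans Hn1 _.
rewrite (big_cat_nat (n := n1) (p := n)) //= lerDl sumr_ge0 //.
Qed.

(** * The mean flow and its Lyapunov function *)

Section Lyapunov.
Context (R : realType).
Implicit Types x a f g m : R.

Definition mean_step m x a := m * x * (2 - a).
Definition mean_nonzero m x a := 2 * a - 3 / 2 * a ^+ 2 + m ^+ 2 * x ^+ 2 / 2.

Definition lyapunov x a := x ^+ 2 * (8 / 3 - a).
(** The derivative of [lyapunov] in the direction (f - x, g - a). *)
Definition lyapunov_rate x a f g :=
  2 * x * (f - x) * (8 / 3 - a) - x ^+ 2 * (g - a).

(** The time derivative of [lyapunov] along the flow is x^2 q.  If m <= 1/2 the
    linear damping of x gives q <= - a.  If m >= 1/2 it may vanish, and the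
    bound m^2 x^2 / 2 >= x^2 / 8 on the push of a by x takes over; the remaining
    terms have the sign of 2/3 - a and cost at most 4e. *)
Lemma lyapunov_rate_le m x a : -1 <= m -> m <= 3 / 4 -> `|x| <= a -> a <= 1 ->
  forall e, 0 <= e -> 2 / 3 - e <= a ->
  lyapunov_rate x a (mean_step m x a) (mean_nonzero m x a)
    <= - x ^+ 4 / 8 + 4 * e.
Proof.
move=> m1 m34 xa a1 e e0 ea.
have a0 : 0 <= a by apply: le_trans xa.
have w0 : 0 <= x ^+ 2 by exact: sqr_ge0.
have wa : x ^+ 2 <= a.
  rewrite -real_normK ?num_real // expr2.
  by apply: (le_trans (ler_pM _ _ xa xa)) => //; nra.
pose q := 2 * (m * (2 - a) - 1) * (8 / 3 - a) + 3 / 2 * a * (a - 2 / 3)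
          - m ^+ 2 * x ^+ 2 / 2.
have -> : lyapunov_rate x a (mean_step m x a) (mean_nonzero m x a) = x ^+ 2 * q.
  by rewrite /lyapunov_rate /mean_step /mean_nonzero /q; field.
suff qle : q <= - x ^+ 2 / 8 + 4 * e.
  apply: le_trans (ler_wpM2l w0 qle) _.
  rewrite (_ : x ^+ 4 = x ^+ 2 * x ^+ 2); last by ring.
  nra.
rewrite /q.
move: (x ^+ 2) w0 wa => w w0 wa.
have [m2|m2] := leP m (1/2).
  have H1 : m * (2 - a) - 1 <= - a / 2 by nra.
  have : 2 * (m * (2 - a) - 1) * (8 / 3 - a) <= - a * (8/3 - a) by nra.
  have : 0 <= m ^+ 2 * w / 2 by rewrite divr_ge0 // mulr_ge0 // sqr_ge0.
  nra.
have H1 : m * (2 - a) - 1 <= - 3 / 4 * (a - 2 / 3) by nra.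
have H2 : 2 * (m * (2 - a) - 1) * (8 / 3 - a) <= - 3 / 2 * (a - 2/3) * (8/3 - a) by nra.
have H3 : w / 8 <= m ^+ 2 * w / 2.
  have : 1 / 4 <= m ^+ 2 by nra.
  nra.
have H4 : - 3 / 2 * (a - 2/3) * (8/3 - a) + 3 / 2 * a * (a - 2 / 3) <= 4 * e.
  by have [b0|b0] := leP (2 / 3) a; nra.
lra.
Qed.

End Lyapunov.

Lemma normM_le (R : realType) (x y b c : R) :
  `|x| <= b -> `|y| <= c -> `|x * y| <= b * c.
Proof. by move=> xb yc; rewrite normrM ler_pM. Qed.

Lemma normD_le (R : realType) (x y b c : R) :
  `|x| <= b -> `|y| <= c -> `|x + y| <= b + c.
Proof. by move=> xb yc; rewrite (le_trans (ler_normD _ _)) ?lerD. Qed.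

(** The rate is a polynomial, hence Lipschitz on bounded sets: it may be evaluated
    at the compensated point (y, b) with the drift (f, g) of the true point. *)
Lemma lyapunov_rate_perturb (R : realType) (x a f g y b e : R) :
  `|x| <= 1 -> `|a| <= 1 -> `|f| <= 2 -> `|g| <= 3 -> e <= 1 ->
  `|y - x| <= e -> `|b - a| <= e ->
  lyapunov_rate y b f g <= lyapunov_rate x a f g + 100 * e.
Proof.
move=> x1 a1 f2 g3 e1 yx ba.
rewrite -lerBlDl; apply: le_trans (ler_norm _) _.
pose d := y - x; pose c := b - a.
have -> : lyapunov_rate y b f g - lyapunov_rate x a f g =
  d * (2 * (f + - (2 * x) + - d) * (8 / 3 + - a + - c) + - ((2 * x + d) * (g + - a + - c)))
  + c * (- (2 * x * (f + - x)) + x * x).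
  by rewrite /lyapunov_rate /d /c; ring.
have e0 : 0 <= e by apply: le_trans yx.
have d1 : `|d| <= 1 by apply: le_trans e1.
have c1 : `|c| <= 1 by apply: le_trans e1.
have n2 : `|2 : R| <= 2 by rewrite ger0_norm.
have n83 : `|8 / 3 : R| <= 3 by rewrite ger0_norm; lra.
apply: (@le_trans _ _ (e * (2 * (2 + 2 * 1 + 1) * (3 + 1 + 1) + (2 * 1 + 1) * (3 + 1 + 1)) + e * (2 * 1 * (2 + 1) + 1 * 1))); last by lra.
by repeat (first [assumption | apply: normD_le | apply: normM_le | rewrite normrN]).
Qed.

(** One Euler step of length h, with the terms of second and third order in h
    collected in the remainder 320 h^2. *)
Lemma lyapunov_step (R : realType) (y b F G h : R) :
  `|y| <= 2 -> `|b| <= 2 -> `|F| <= 4 -> `|G| <= 5 -> 0 <= h -> h <= 1 ->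
  lyapunov (y + F * h) (b + G * h) <=
  lyapunov y b + h * (2 * y * F * (8 / 3 - b) - y ^+ 2 * G + 320 * h).
Proof.
move=> y2 b2 F4 G5 h0 h1.
have -> : lyapunov (y + F * h) (b + G * h) = lyapunov y b + h * (2 * y * F * (8 / 3 - b) - y ^+ 2 * G
   + h * (F * F * (8 / 3 + - b) + - (2 * y * F * G) + - (F * F * G * h))).
  by rewrite /lyapunov; ring.
rewrite lerD2l ler_wpM2l // lerD2l [320 * h]mulrC ler_wpM2l //.
apply: le_trans (ler_norm _) _.
have n2 : `|2 : R| <= 2 by rewrite ger0_norm.
have n83 : `|8 / 3 : R| <= 3 by rewrite ger0_norm; lra.
have nh : `|h| <= 1 by rewrite ger0_norm.
apply: (@le_trans _ _ (4 * 4 * (3 + 2) + 2 * 2 * 4 * 5 + 4 * 4 * 5 * 1)); last by lra.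
by repeat (first [assumption | apply: normD_le | apply: normM_le | rewrite normrN]).
Qed.

Lemma mean_bounds (R : realType) (m x a : R) :
  -1 <= m -> m <= 1 -> `|x| <= a -> a <= 1 ->
  `|mean_step m x a| <= 2 /\ `|mean_nonzero m x a| <= 3.
Proof.
move=> m1 m2 xa a1.
have a0 : 0 <= a by apply: le_trans xa.
have nm : `|m| <= 1 by rewrite ler_norml m1 m2.
have nx : `|x| <= 1 by apply: le_trans a1.
split; rewrite /mean_step /mean_nonzero.
  apply: (le_trans (normM_le (normM_le nm nx) (_ : _ <= 2))); last by lra.
  by rewrite ger0_norm; lra.
have mx : `|m * x| <= 1 by apply: (le_trans (normM_le nm nx)); lra.
move: mx; rewrite ler_norml => /andP[h1 h2].
rewrite -exprMn ler_norml; apply/andP; split; nra.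
Qed.

Lemma mean_nonzero_le (R : realType) (m x a : R) :
  -1 <= m -> m <= 1 ->
  mean_nonzero m x a - a <= - (3 / 2) * a * (a - 2 / 3) + x ^+ 2 / 2.
Proof.
move=> m1 m2; rewrite /mean_nonzero.
have : m ^+ 2 * x ^+ 2 <= x ^+ 2 by rewrite ler_piMl ?sqr_ge0 //; nra.
move: (x ^+ 2) (m ^+ 2) => w v; nra.
Qed.

Lemma mean_nonzero_ge (R : realType) (m x a : R) :
  (3 / 2) * a * (2 / 3 - a) <= mean_nonzero m x a - a.
Proof.
rewrite /mean_nonzero -exprMn.
by have := sqr_ge0 (m * x); move: (_ ^+ 2) => w w0; nra.
Qed.

(** At a high level of [lyapunov] the quartic gain of [lyapunov_rate_le] is bounded
    away from zero. *)
Lemma lyapunov_lower (R : realType) (x y b e : R) :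
  0 < e -> e <= lyapunov y b -> -2 <= b -> `|x| <= 1 ->
  `|y - x| <= e / 50 -> `|y - x| <= 1 -> e * e / 100 <= x ^+ 4.
Proof.
move=> e0 eL b2 x1 c1 c2.
have y2 : e / 5 <= y ^+ 2.
  by move: eL; rewrite /lyapunov; have := sqr_ge0 y; move: (y ^+ 2) => w; nra.
have d2 : `|y ^+ 2 - x ^+ 2| <= e / 50 * 3.
  rewrite subr_sqr; apply: normM_le => //.
  rewrite (_ : y + x = (y - x) + (x + x)); last by ring.
  by apply: (le_trans (normD_le c2 (normD_le x1 x1))); clear; lra.
have x2 : e / 10 <= x ^+ 2.
  move: d2 y2; rewrite ler_norml; move: (y ^+ 2) (x ^+ 2) => w v /andP[_ +]; clear -e0; lra.
have -> : x ^+ 4 = x ^+ 2 * x ^+ 2 by ring.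
move: (x ^+ 2) x2 => v; clear -e0; nra.
Qed.

(** Asymptotics of an Euler scheme (y, b) whose drift is read at a nearby point
    (x, a). *)
Section MeanFlow.
Context (R : realType) (m : R) (x a y b : nat -> R).
Context (m_ge : -1 <= m).
Context (m_le : m <= 3 / 4).
Context (x_le : forall n, `|x n| <= a n).
Context (a_le : forall n, a n <= 1).
Context (yS : \forall n \near \oo,
  y n.+1 = y n + (mean_step m (x n) (a n) - y n) / n.+1%:R).
Context (bS : \forall n \near \oo,
  b n.+1 = b n + (mean_nonzero m (x n) (a n) - b n) / n.+1%:R).
Context (yx : y n - x n @[n --> \oo] --> (0 : R)).
Context (ba : b n - a n @[n --> \oo] --> (0 : R)).
Context (a_recurrent : forall N, exists2 n, (N <= n)%N & 1 / 3 <= a n).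

Let a_ge0 n : 0 <= a n.
Proof. exact: le_trans (x_le n). Qed.

Let x_le1 n : `|x n| <= 1.
Proof. exact: le_trans (a_le n). Qed.

Let a_le1 n : `|a n| <= 1.
Proof. by rewrite ger0_norm. Qed.

Let m_le1 : m <= 1.
Proof. by apply: le_trans m_le _; lra. Qed.

Let f_le n : `|mean_step m (x n) (a n)| <= 2.
Proof. by have [] := mean_bounds m_ge m_le1 (x_le n) (a_le n). Qed.

Let g_le n : `|mean_nonzero m (x n) (a n)| <= 3.
Proof. by have [] := mean_bounds m_ge m_le1 (x_le n) (a_le n). Qed.

Let y_close (e : R) : 0 < e -> \forall n \near \oo, `|y n - x n| <= e.
Proof. exact: (cvgr0_norm_le _ yx). Qed.

Let b_close (e : R) : 0 < e -> \forall n \near \oo, `|b n - a n| <= e.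
Proof. exact: (cvgr0_norm_le _ ba). Qed.

Lemma b_step_le : \forall n \near \oo, `|b n.+1 - b n| <= 5 / n.+1%:R.
Proof.
near=> n.
have -> : b n.+1 - b n = (mean_nonzero m (x n) (a n) - b n) / n.+1%:R.
  by rewrite (near bS n) //; ring.
rewrite normrM (@ger0_norm _ _^-1) ?invr_ge0 // ler_wpM2r ?invr_ge0 //.
have hb : `|b n - a n| <= 1 by near: n; exact: b_close.
move: (g_le n) (a_le1 n) hb; rewrite !ler_norml.
by move=> /andP[? ?] /andP[? ?] /andP[? ?]; apply/andP; split; lra.
Unshelve. all: by end_near. Qed.

(** The push by x only increases a, so a alone satisfies
    a' >= (3/2) a (2/3 - a); the recurrence hypothesis keeps it off the rest
    point 0. *)
Lemma nonzero_fraction_liminf (e : R) : 0 < e -> \forall n \near \oo, 2 / 3 - e <= b n.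
Proof.
move=> e0.
suff : \forall n \near \oo, 2 / 3 - b n <= e.
  by apply: filterS => n; lra.
move: e e0; apply: (@drift_limsup_le0 R _ (1 / 2) 5) => //.
- move=> e e0; exists (e / 32); first by lra.
  near=> n => /andP[eb be].
  rewrite (near bS n) //.
  have h1 : `|b n - a n| <= e / 32 by near: n; apply: b_close; lra.
  have h2 : `|b n - a n| <= 1 / 12 by near: n; apply: b_close; lra.
  have h : e / 32 <= mean_nonzero m (x n) (a n) - b n.
    move: h1 h2; rewrite !ler_norml => /andP[? ?] /andP[? ?].
    have := mean_nonzero_ge m (x n) (a n).
    have : (1 / 12) * (e / 2) <= a n * (2 / 3 - a n) by apply: ler_pM; lra.
    lra.
  have : e / 32 / n.+1%:R <= (mean_nonzero m (x n) (a n) - b n) / n.+1%:R.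
    by rewrite ler_wpM2r ?invr_ge0.
  by rewrite opprD addrA lerD2l lerN2.
- apply: filterS b_step_le => n; rewrite ler_norml.
  by move: (5 / _) => z /andP[? ?]; lra.
- move=> N; have [N1 _ H] := b_close (ltac:(lra) : 0 < 1 / 12 :> R).
  have [n nN an] := a_recurrent (N + N1)%N.
  exists n; first by rewrite (leq_trans _ nN) // leq_addr.
  have := H n (leq_trans (leq_addl _ _) nN).
  rewrite ler_norml => /andP[? ?]; lra.
Unshelve. all: by end_near. Qed.

(** At level e the decrease of order e^2 dominates all errors: the distance of
    (y, b) to (x, a), the defect of a below 2/3, and the discretization. *)
Lemma lyapunov_cvg0 (e : R) : 0 < e -> \forall n \near \oo, lyapunov (y n) (b n) <= e.
Proof.
have step (d : R) : 0 < d -> \forall n \near \oo,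
    lyapunov (y n.+1) (b n.+1) <=
    lyapunov (y n) (b n) + n.+1%:R^-1 * (- x n ^+ 4 / 8 + d).
  (* 424 = 4 + 100 + 320, one summand for each of the three errors. *)
  move=> d0; pose r := d / 424.
  have r0 : 0 < r by rewrite /r; lra.
  near=> n.
  have h0 : 0 <= n.+1%:R^-1 :> R by rewrite invr_ge0.
  have h1 : n.+1%:R^-1 <= 1 :> R by rewrite invf_le1 // ler1n.
  have hr : n.+1%:R^-1 <= r.
    near: n; apply: filterS (@harmonic_eventually_small _ 1 r r0) => n.
    by rewrite mul1r.
  have c1 : `|y n - x n| <= Num.min r 1 by near: n; apply: y_close; rewrite lt_min r0 ltr01.
  have c2 : `|b n - a n| <= Num.min r 1 by near: n; apply: b_close; rewrite lt_min r0 ltr01.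
  have c3 : 2 / 3 - r <= a n.
    have : 2 / 3 - r / 2 <= b n by near: n; apply: nonzero_fraction_liminf; lra.
    have : `|b n - a n| <= r / 2 by near: n; apply: b_close; lra.
    by rewrite ler_norml => /andP[? ?] ?; lra.
  have p1 : Num.min r 1 <= 1 by rewrite ge_min lexx orbT.
  have pr : Num.min r 1 <= r by rewrite ge_min lexx.
  have y2 : `|y n| <= 2.
    rewrite -(subrK (x n) (y n)); apply: (le_trans (normD_le (le_trans c1 p1) (x_le1 n))); lra.
  have b2 : `|b n| <= 2.
    rewrite -(subrK (a n) (b n)); apply: (le_trans (normD_le (le_trans c2 p1) (a_le1 n))); lra.
  rewrite (near yS n) // (near bS n) //.
  set f := mean_step _ _ _; set g := mean_nonzero _ _ _.
  have F4 : `|f - y n| <= 4.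
    apply: (le_trans (normD_le (f_le n) (_ : _ <= 2))); rewrite ?normrN //; lra.
  have G5 : `|g - b n| <= 5.
    apply: (le_trans (normD_le (g_le n) (_ : _ <= 2))); rewrite ?normrN //; lra.
  apply: (le_trans (lyapunov_step y2 b2 F4 G5 h0 h1)).
  rewrite lerD2l ler_wpM2l //.
  have H1 := lyapunov_rate_perturb (x_le1 n) (a_le1 n) (f_le n) (g_le n) p1 c1 c2.
  have H2 := lyapunov_rate_le m_ge m_le (x_le n) (a_le n) (ltW r0) c3.
  rewrite -/f -/g in H1 H2.
  rewrite /lyapunov_rate in H1 H2 *.
  have dr : d = 424 * r by rewrite /r; field.
  move: H1 H2 hr; rewrite dr; move: (n.+1%:R^-1) (2 * y n * _ * _ - _) => h s.
  move: (2 * x n * _ * _ - _) (x n ^+ 4) (Num.min r 1) pr => s' x4 r' pr.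
  by lra.
move: e; apply: (@drift_limsup_le0 R _ 20 1) => //.
- move=> e e0; have e20 : 0 < e * e by rewrite mulr_gt0.
  have d0 : 0 < e * e / 1600 by lra.
  exists (e * e / 1600) => //.
  near=> n => /andP[eL _].
  have := near (step _ d0) n; move=> /(_ ltac:(by [])) H.
  apply: (le_trans H); rewrite lerD2l [leLHS]mulrC -[leRHS]mulNr ler_wpM2r ?invr_ge0 //.
  have c1 : `|y n - x n| <= Num.min (e / 50) 1.
    by near: n; apply: y_close; rewrite lt_min ltr01 divr_gt0.
  have b2 : -2 <= b n.
    have : 2 / 3 - 1 <= b n by near: n; apply: nonzero_fraction_liminf.
    lra.
  move: c1; rewrite le_min => /andP[c1 c1'].
  have := lyapunov_lower e0 eL b2 (x_le1 n) c1 c1'.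
  move: (x n ^+ 4) => x4 x4e; move: (e * e) x4e => z z4; lra.
- apply: filterS (step 1 ltr01) => n H; apply: (le_trans H).
  rewrite lerD2l mulrC ler_wpM2r ?invr_ge0 //.
  have : 0 <= x n ^+ 4 by rewrite (exprM _ 2 2) sqr_ge0.
  lra.
- move=> N.
  have [N1 _ H1] := y_close ltr01; have [N2 _ H2] := b_close ltr01.
  exists (N + N1 + N2)%N; first by rewrite -addnA leq_addr.
  have {}H1 := H1 (N + N1 + N2)%N (leq_trans (leq_addl _ _) (leq_addr _ _)).
  have {}H2 := H2 (N + N1 + N2)%N (leq_addl _ _).
  set n := (N + N1 + N2)%N in H1 H2 *.
  have y2 : `|y n| <= 2.
    rewrite -(subrK (x n) (y n)); apply: (le_trans (normD_le H1 (x_le1 n))); lra.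
  have b2 : `|b n| <= 2.
    rewrite -(subrK (a n) (b n)); apply: (le_trans (normD_le H2 (a_le1 n))); lra.
  apply: le_trans (ler_norm _) _; rewrite /lyapunov expr2.
  apply: (le_trans (normM_le (normM_le y2 y2) (_ : _ <= 5))); last by lra.
  by move: b2; rewrite !ler_norml => /andP[? ?]; apply/andP; split; lra.
Unshelve. all: by end_near. Qed.

Lemma step_fraction_cvg0 : x n @[n --> \oo] --> (0 : R).
Proof.
have y0 : y n @[n --> \oo] --> (0 : R).
  apply/cvgr0Pnorm_le => e e0.
  near=> n.
  have L : lyapunov (y n) (b n) <= e ^+ 2 / 2.
    by near: n; apply: lyapunov_cvg0; rewrite divr_gt0 // exprn_gt0.
  have b1 : b n <= 2.
    have : `|b n - a n| <= 1 by near: n; exact: b_close.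
    by move: (a_le n); rewrite ler_norml => ? /andP[? ?]; lra.
  rewrite -(ler_pXn2r (n := 2)) ?nnegrE ?(ltW e0) // real_normK ?num_real //.
  move: L; rewrite /lyapunov; move: (sqr_ge0 (y n)) (sqr_ge0 (e : R)).
  move: (y n ^+ 2) (e ^+ 2) => w z w0 z0; nra.
have -> : x = (fun n => y n - (y n - x n)).
  by apply/funext => n; rewrite opprB addrC subrK.
by rewrite -[X in _ --> X]subr0; exact: cvgB y0 yx.
Unshelve. all: by end_near. Qed.

Lemma nonzero_fraction_cvg : a n @[n --> \oo] --> (2 / 3 : R).
Proof.
have upper (e : R) : 0 < e -> \forall n \near \oo, b n - 2 / 3 <= e.
  move: e; apply: (@drift_limsup_le0 R _ 2 5) => //.
  - move=> e e0.
    exists (e / 4); first by lra.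
    near=> n => /andP[eb _].
    have c1 : `|b n - a n| <= e / 8 by near: n; apply: b_close; lra.
    have x2 : x n ^+ 2 <= e / 4.
      have c : `|x n| <= e / 4.
        by near: n; apply: cvgr0_norm_le; [exact: step_fraction_cvg0|lra].
      have := normM_le c (x_le1 n); rewrite -expr2 mulr1.
      exact: le_trans (ler_norm _).
    rewrite (near bS n) //.
    have h : mean_nonzero m (x n) (a n) - b n <= - (e / 4).
      have := mean_nonzero_le (x n) (a n) m_ge m_le1.
      move: c1; rewrite ler_norml => /andP[? ?].
      have : 2 / 3 * (7 / 8 * e) <= a n * (a n - 2 / 3) by apply: ler_pM; lra.
      by lra.
    have : (mean_nonzero m (x n) (a n) - b n) / n.+1%:R <= - (e / 4) / n.+1%:R.
      by rewrite ler_wpM2r ?invr_ge0.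
    by rewrite mulNr => H; rewrite [leLHS]addrAC lerD2l.
  - apply: filterS b_step_le => n; rewrite ler_norml.
    by move: (5 / _) => z /andP[? ?]; lra.
  - move=> N; have [N1 _ H] := b_close ltr01.
    exists (N + N1)%N; first exact: leq_addr.
    have := H _ (leq_addl N N1); rewrite ler_norml => /andP[? ?].
    by have := a_le (N + N1)%N; lra.
have b23 : b n @[n --> \oo] --> (2 / 3 : R).
  apply/cvgrPdist_le => e e0; near=> n.
  rewrite distrC ler_norml; apply/andP; split.
    by rewrite lerBrDl; near: n; exact: nonzero_fraction_liminf.
  by near: n; exact: upper.
have -> : a = (fun n => b n - (b n - a n)).
  by apply/funext => n; rewrite opprB addrC subrK.
by rewrite -[X in _ --> X]subr0; exact: cvgB b23 ba.
Unshelve. all: by end_near. Qed.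

End MeanFlow.

(** * Averages over the paths of the walk *)

Section PathExpectation.
Context (R : realType) (p : R).
Context (p_ge0 : 0 <= p).
Context (p_le1 : p <= 1).
Implicit Types (x : seq R) (g h : R -> R) (n k : nat).

Definition sign_of (s : bool) : R := if s then 1 else -1.
Definition sign_weight (s : bool) : R := if s then p else 1 - p.

(** The index u of a channel stands for the time u + 1, since times start at 1 and
    sequences at 0. *)
Definition channel n := ('I_n * bool)%type.
Definition channel_weight n (c : channel n) : R := n%:R^-1 * sign_weight c.2.
Definition recalled x n (c : channel n) : R := sign_of c.2 * x`_c.1.

Definition draw n := (channel n * channel n)%type.
Definition draw_weight n (c : draw n) : R :=
  channel_weight c.1 * channel_weight c.2.
Definition new_step x n (c : draw n) : R :=
  Num.sg (recalled x c.1 + recalled x c.2).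

Definition next_mean n g x : R :=
  \sum_(c : draw n) draw_weight c * g (new_step x c).

(** The expectation of h over the first n + 2 steps; the first two are fair signs,
    so the recursion starts there. *)
Fixpoint path_mean n (h : seq R -> R) : R :=
  if n is n'.+1 then
    path_mean n' (fun x => next_mean n'.+2 (fun e => h (rcons x e)) x)
  else \sum_(s : bool * bool) 4^-1 * h [:: sign_of s.1; sign_of s.2].

Definition nonzero (e : R) : R := (e != 0)%:R.
Definition displacement n x : R := \sum_(0 <= j < n) x`_j.
Definition activity n x : R := \sum_(0 <= j < n) nonzero x`_j.

Definition possible_step (e : R) := [|| e == -1, e == 0 | e == 1].
(** The first two steps are nonzero, hence the bound 2; it makes 1 / (activity - 1)
    meaningful below. *)
Definition possible_path n x :=
  [/\ size x = n, all possible_step x & 2 <= activity n x].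

Lemma channel_weight_ge0 n (c : channel n) : 0 <= channel_weight c.
Proof.
by rewrite mulr_ge0 ?invr_ge0 // /sign_weight; case: ifP; rewrite ?subr_ge0.
Qed.

Lemma draw_weight_ge0 n (c : draw n) : 0 <= draw_weight c.
Proof. by rewrite mulr_ge0 ?channel_weight_ge0. Qed.

Definition channel_mean n g x : R :=
  n%:R^-1 * \sum_(u < n) (p * g x`_u + (1 - p) * g (- x`_u)).

Lemma channel_meanE n g x :
  \sum_(c : channel n) channel_weight c * g (recalled x c) = channel_mean n g x.
Proof.
rewrite /channel_mean mulr_sumr -(pair_bigA _ (fun u s =>
  channel_weight (u, s) * g (recalled x (u, s)))) /=.
apply: eq_bigr => u _; rewrite big_bool /channel_weight /recalled /=.
by rewrite mul1r mulN1r; ring.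
Qed.

Lemma draw_mean_prod n g h x :
  \sum_(c : draw n) draw_weight c * (g (recalled x c.1) * h (recalled x c.2))
  = channel_mean n g x * channel_mean n h x.
Proof.
rewrite -!channel_meanE big_distrlr /= pair_bigA /=.
by apply: eq_bigr => c _; rewrite /draw_weight; ring.
Qed.

Lemma channel_mean1 n x : (0 < n)%N -> channel_mean n (fun _ => 1) x = 1.
Proof.
move=> n0; rewrite /channel_mean (eq_bigr (fun _ => 1)); last by move=> *; ring.
by rewrite sumr_const card_ord mulVf // pnatr_eq0 -lt0n.
Qed.

Lemma sum_draw_weight n : (0 < n)%N -> \sum_(c : draw n) draw_weight c = 1.
Proof.
move=> n0; have := draw_mean_prod n (fun _ => 1) (fun _ => 1) [::].
rewrite channel_mean1 // mulr1 => <-.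
by apply: eq_bigr => c _; rewrite !mulr1.
Qed.

Lemma next_mean_le n g h x : (forall c : draw n, g (new_step x c) <= h (new_step x c)) ->
  next_mean n g x <= next_mean n h x.
Proof. by move=> gh; apply: ler_sum => c _; rewrite ler_wpM2l ?draw_weight_ge0. Qed.

Lemma next_mean_affine n (a b : R) g x : (0 < n)%N ->
  next_mean n (fun e => a + b * g e) x = a + b * next_mean n g x.
Proof.
move=> n0; rewrite /next_mean mulr_sumr -[a in RHS]mulr1 -(sum_draw_weight n0) mulr_sumr.
by rewrite -big_split; apply: eq_bigr => c _ /=; ring.
Qed.

Lemma next_mean_rcons n g x e : (n <= size x)%N ->
  next_mean n g (rcons x e) = next_mean n g x.
Proof.
move=> nx; apply: eq_bigr => c _; rewrite /new_step /recalled !nth_rcons.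
by rewrite !(leq_trans (ltn_ord _) nx).
Qed.

Lemma possible_sign s : possible_step (sign_of s).
Proof. by case: s; rewrite /possible_step /= eqxx ?orbT. Qed.

Lemma possible_new_step x n (c : draw n) : possible_step (new_step x c).
Proof.
by rewrite /new_step /possible_step; case: sgrP; rewrite eqxx ?orbT.
Qed.

Lemma nth_possible x u : all possible_step x -> possible_step x`_u.
Proof.
move=> xp; have [us|us] := ltnP u (size x); first exact: (allP xp) (mem_nth _ us).
by rewrite nth_default // /possible_step eqxx orbT.
Qed.

Lemma activity_rcons n x e : size x = n ->
  activity n.+1 (rcons x e) = activity n x + nonzero e.
Proof.
move=> xn; rewrite /activity big_nat_recr //= nth_rcons xn ltnn eqxx; congr (_ + _).
by apply: eq_big_nat => j /andP[_ jn]; rewrite nth_rcons xn jn.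
Qed.

Lemma possible_path_rcons n x e : possible_path n x -> possible_step e ->
  possible_path n.+1 (rcons x e).
Proof.
move=> [xn xp xa] ep; split; first by rewrite size_rcons xn.
  by rewrite all_rcons ep.
by rewrite activity_rcons // (le_trans xa) // lerDl ler0n.
Qed.

Lemma next_mean_norm_le n g x : (0 < n)%N ->
  (forall e, possible_step e -> `|g e| <= 1) -> `|next_mean n g x| <= 1.
Proof.
move=> n0 g1; rewrite -(sum_draw_weight n0); apply: (le_trans (ler_norm_sum _ _ _)).
apply: ler_sum => c _; rewrite normrM ger0_norm ?draw_weight_ge0 //.
by rewrite ler_piMr ?draw_weight_ge0 // g1 // possible_new_step.
Qed.

Lemma path_mean_le n (h h' : seq R -> R) :
  (forall x, possible_path n.+2 x -> h x <= h' x) -> path_mean n h <= path_mean n h'.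
Proof.
elim: n h h' => [|n IH] h h' hh /=.
  apply: ler_sum => s _; rewrite ler_wpM2l ?invr_ge0 //; apply: hh; split => //=.
    by rewrite !possible_sign.
  rewrite /activity !big_nat_recr //= big_geq // add0r /nonzero.
  by case: s => -[] [] /=; rewrite ?oppr_eq0 oner_eq0.
apply: IH => x xp; apply: next_mean_le => c; apply: hh.
exact: possible_path_rcons (possible_new_step _ _).
Qed.

Lemma path_mean_eq n (h h' : seq R -> R) :
  (forall x, possible_path n.+2 x -> h x = h' x) -> path_mean n h = path_mean n h'.
Proof. by move=> hh; apply/eqP; rewrite eq_le !path_mean_le // => x /hh ->. Qed.

Lemma path_mean_affine n (a b : R) (h : seq R -> R) :
  path_mean n (fun x => a + b * h x) = a + b * path_mean n h.
Proof.
elim: n h => [|n IH] h /=.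
  rewrite mulr_sumr -[a in RHS](_ : \sum_(s : bool * bool) 4^-1 * a = a); last first.
    by rewrite sumr_const card_prod card_bool -mulr_natl; field.
  by rewrite -big_split; apply: eq_bigr => s _ /=; ring.
rewrite -IH; apply: path_mean_eq => x _; exact: next_mean_affine.
Qed.

Lemma path_mean_sum n (I : finType) (a : I -> R) (h : I -> seq R -> R) :
  path_mean n (fun x => \sum_i a i * h i x) = \sum_i a i * path_mean n (h i).
Proof.
elim: n h => [|n IH] h /=.
  under eq_bigr do rewrite mulr_sumr.
  rewrite exchange_big; apply: eq_bigr => i _; rewrite mulr_sumr.
  by apply: eq_bigr => s _; rewrite mulrCA.
rewrite -IH; apply: path_mean_eq => x _; rewrite /next_mean.
under eq_bigr do rewrite mulr_sumr.
rewrite exchange_big; apply: eq_bigr => i _; rewrite mulr_sumr.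
by apply: eq_bigr => s _; rewrite mulrCA.
Qed.

(** ** Second moment of the noise *)

(** The martingale part of the sum of g over the steps.  The entries of
    index 0 and 1 are not drawn through the channels. *)
Definition noise (g : R -> R) n x : R :=
  \sum_(2 <= k < n) (g x`_k - next_mean k g x).

Lemma noise_rcons g n x e : (2 <= n)%N -> size x = n ->
  noise g n.+1 (rcons x e) = noise g n x + (g e - next_mean n g x).
Proof.
move=> n2 xn; rewrite /noise big_nat_recr //= nth_rcons xn ltnn eqxx.
rewrite next_mean_rcons ?xn //; congr (_ + _).
apply: eq_big_nat => j /andP[_ jn]; rewrite nth_rcons xn jn.
by rewrite next_mean_rcons // xn ltnW.
Qed.

(** Orthogonality of the increments: with mu the conditional mean of g, the cross
    terms average to zero and each step adds at most the mean of g^2. *)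
Lemma path_mean_noise g n : (forall e, possible_step e -> `|g e| <= 1) ->
  path_mean n (fun x => noise g n.+2 x ^+ 2) <= n%:R.
Proof.
move=> g1; elim: n => [|n IH].
  have H0 : path_mean 0 (fun _ => 0 + 0 * 0) = 0.
    by have -> := path_mean_affine 0 0 0 (fun _ => 0); rewrite mul0r addr0.
  rewrite -[leRHS]H0; apply: path_mean_le => x _.
  by rewrite /noise big_geq // expr0n /= mul0r addr0.
have gsq e : possible_step e -> g e ^+ 2 <= 1.
  by move=> ep; rewrite -real_normK ?num_real // expr_le1 // g1.
rewrite -natr1 addrC /=.
apply: (@le_trans _ _ (path_mean n (fun x => 1 + 1 * noise g n.+2 x ^+ 2))); last first.
  by rewrite path_mean_affine mul1r lerD2l.
apply: path_mean_le => x [xn _ _].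
set z := noise g n.+2 x; set mu := next_mean n.+2 g x.
(* Bounding only the square of g leaves an expression affine in g, whose mean is exact. *)
apply: (@le_trans _ _ (next_mean n.+2 (fun e => ((z - mu) ^+ 2 + 1) + 2 * (z - mu) * g e) x)).
  apply: next_mean_le => c; rewrite noise_rcons // -/z -/mu.
  by have := gsq _ (possible_new_step x c); nra.
rewrite next_mean_affine // -/mu.
by have := sqr_ge0 mu; nra.
Qed.

(** ** Conditional law of the next step *)

Lemma channel_mean_id n x :
  channel_mean n id x = (2 * p - 1) * (displacement n x / n%:R).
Proof.
rewrite /channel_mean /displacement big_mkord mulrA [RHS]mulrC; congr (_ * _).
by rewrite mulr_sumr; apply: eq_bigr => u _ /=; ring.
Qed.

Lemma channel_mean_sqr n x : all possible_step x ->
  channel_mean n (fun e => e ^+ 2) x = activity n x / n%:R.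
Proof.
move=> xp; rewrite /channel_mean /activity big_mkord mulrC; congr (_ * _).
apply: eq_bigr => u _; rewrite sqrrN -mulrDl subrKC mul1r /nonzero.
by case/or3P: (nth_possible u xp) => /eqP ->; rewrite ?oppr_eq0 ?oner_eq0 ?eqxx /=; ring.
Qed.

Lemma possible_recalled x n (c : channel n) :
  all possible_step x -> possible_step (recalled x c).
Proof.
move=> xp; rewrite /recalled /sign_of /possible_step.
case/or3P: (nth_possible c.1 xp) => /eqP ->; case: ifP => _;
  by rewrite ?mulN1r ?mul1r ?opprK ?oppr0 eqxx ?orbT.
Qed.

(** Polynomial form of the sign on possible steps, so that the average over draws
    factors through the two channels. *)
Lemma sg_possible (e f : R) : possible_step e -> possible_step f ->
  Num.sg (e + f) = e + f - (e * f ^+ 2 + e ^+ 2 * f) / 2.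
Proof.
have h2 : Num.sg (1 + 1 : R) = 1 by rewrite gtr0_sg.
have h2' : Num.sg (- 1 - 1 : R) = -1 by rewrite -opprD sgrN h2.
by case/or3P => /eqP -> /or3P[] /eqP ->;
  rewrite ?addr0 ?add0r ?subrr ?addNr ?h2 ?h2' ?sgrN ?sgr0 ?sgr1; field.
Qed.

Lemma nonzero_possible (e f : R) : possible_step e -> possible_step f ->
  nonzero (Num.sg (e + f)) =
  e ^+ 2 + f ^+ 2 - 3 / 2 * (e ^+ 2 * f ^+ 2) + (e * f) / 2.
Proof.
have h2 : (1 + 1 : R) != 0 by rewrite (_ : 1 + 1 = 2%:R) // pnatr_eq0.
have h2' : (- 1 - 1 : R) != 0 by rewrite -opprD oppr_eq0.
rewrite /nonzero sgr_eq0.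
by case/or3P => /eqP -> /or3P[] /eqP ->;
  rewrite ?addr0 ?add0r ?subrr ?addNr ?h2 ?h2' ?oppr_eq0 ?oner_eq0 ?eqxx /=; field.
Qed.

Lemma next_mean_id n x : (0 < n)%N -> all possible_step x ->
  next_mean n id x =
  mean_step (2 * p - 1) (displacement n x / n%:R) (activity n x / n%:R).
Proof.
move=> n0 xp; have M g h := draw_mean_prod n g h x.
rewrite /next_mean (eq_bigr (fun c : draw n =>
    draw_weight c * (recalled x c.1 * 1)
  + draw_weight c * (1 * recalled x c.2)
  + - 2^-1 * (draw_weight c * (recalled x c.1 * recalled x c.2 ^+ 2))
  + - 2^-1 * (draw_weight c * (recalled x c.1 ^+ 2 * recalled x c.2)))).
  rewrite !big_split /= -!mulr_sumr (M id (fun=> 1)) (M (fun=> 1) id).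
  rewrite (M id (fun e => e ^+ 2)) (M (fun e => e ^+ 2) id).
  rewrite channel_mean1 // channel_mean_id channel_mean_sqr // /mean_step.
  by field; rewrite pnatr_eq0 -lt0n.
by move=> c _; rewrite /new_step sg_possible ?possible_recalled //; field.
Qed.

Lemma next_mean_nonzero n x : (0 < n)%N -> all possible_step x ->
  next_mean n nonzero x =
  mean_nonzero (2 * p - 1) (displacement n x / n%:R) (activity n x / n%:R).
Proof.
move=> n0 xp; have M g h := draw_mean_prod n g h x.
rewrite /next_mean (eq_bigr (fun c : draw n =>
    draw_weight c * (recalled x c.1 ^+ 2 * 1)
  + draw_weight c * (1 * recalled x c.2 ^+ 2)
  + - (3 / 2) * (draw_weight c * (recalled x c.1 ^+ 2 * recalled x c.2 ^+ 2))
  + 2^-1 * (draw_weight c * (recalled x c.1 * recalled x c.2)))).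
  rewrite !big_split /= -!mulr_sumr (M (fun e => e ^+ 2) (fun=> 1)).
  rewrite (M (fun=> 1) (fun e => e ^+ 2)) (M (fun e => e ^+ 2) (fun e => e ^+ 2)) (M id id).
  rewrite channel_mean1 // channel_mean_id channel_mean_sqr // /mean_nonzero.
  by field; rewrite pnatr_eq0 -lt0n.
by move=> c _; rewrite /new_step nonzero_possible ?possible_recalled //; field.
Qed.

(** ** Escape from low activity *)

Lemma activity_le n x : activity n x <= n%:R.
Proof.
rewrite /activity big_mkord -[leRHS]mulr1 mulr_natl -[in leRHS](card_ord n) -sumr_const.
by apply: ler_sum => u _; rewrite /nonzero; case: (_ == 0).
Qed.

Definition low_activity N n x :=
  all (fun k => activity k x < k%:R / 3) (index_iota N n.+1).

(** Among the functions 1 / (A - c), the choice c = 1 makes the contraction factor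
    exactly 1 - q / A with q the probability of a nonzero step.  When A / n is
    small, q / A is close to 2 / n, so the potential decays faster than 1 / n, which
    is a lower bound of 1 / (A - 1). *)
Definition low_potential N n x : R :=
  (low_activity N n x)%:R / (activity n x - 1).

Lemma activity_rcons_le n x e : (n <= size x)%N ->
  activity n (rcons x e) = activity n x.
Proof.
move=> nx; apply: eq_big_nat => j /andP[_ jn].
by rewrite nth_rcons (leq_trans jn nx).
Qed.

Lemma low_activity_rcons N n x e : size x = n ->
  low_activity N n.+1 (rcons x e) -> low_activity N n x.
Proof.
move=> xn /allP L; apply/allP => k; rewrite mem_index_iota => /andP[Nk kn].
have := L k; rewrite mem_index_iota Nk ltnS ltnW // => /(_ isT).
by rewrite activity_rcons_le // xn.
Qed.

(** For a <= 1/3 the probability of a nonzero step is at least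
    2a - (3/2) a^2 >= (3/2) a. *)
Lemma low_potential_contract N n x : (0 < n)%N -> (N <= n)%N -> possible_path n x ->
  next_mean n (fun e => low_potential N n.+1 (rcons x e)) x
    <= (1 - 3 / 2 / n%:R) * low_potential N n x.
Proof.
move=> n0 Nn [xn xp xa]; rewrite /low_potential.
have [L|L] := boolP (low_activity N n x); last first.
  rewrite mul0r mulr0; apply: (@le_trans _ _ (next_mean n (fun _ => 0 + 0 * 0) x)).
    apply: next_mean_le => c.
    rewrite (negbTE (contra (low_activity_rcons (e := new_step x c) xn) L)).
    by rewrite mul0r mulr0 addr0.
  by rewrite (next_mean_affine 0 0 (fun=> 0)) // mul0r addr0.
have q := next_mean_nonzero n0 xp.
set A := activity n x in xa q *; set nR : R := n%:R in q *.
have nR0 : 0 < nR by rewrite ltr0n.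
have An : A < nR / 3.
  by apply: (allP L); rewrite mem_index_iota Nn ltnSn.
apply: (@le_trans _ _ (next_mean n (fun e => (A - 1)^-1 + ((A^-1 - (A - 1)^-1) * nonzero e)) x)).
  apply: next_mean_le => c; rewrite activity_rcons // -/A.
  have [B|B] := boolP (low_activity _ _ _); last first.
    rewrite mul0r /nonzero; case: (_ == 0); rewrite ?mulr0 ?addr0 ?mulr1 ?subrKC ?invr_ge0; lra.
  rewrite mul1r /nonzero; case: (_ == 0); rewrite ?mulr0 ?addr0 ?mulr1 ?subrKC ?addrK //.
rewrite next_mean_affine // q mul1r.
have a0 : 0 < A / nR by rewrite divr_gt0 //; lra.
have a3 : A / nR <= 1 / 3 by rewrite ler_pdivrMr //; lra.
have := mean_nonzero_ge (2 * p - 1) (displacement n x / nR) (A / nR).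
move: (mean_nonzero _ _ _) => g gE.
have gA : 3 / 2 * (A / nR) <= g by nra.
have A0 : A != 0 by rewrite gt_eqF //; lra.
have A1 : A - 1 != 0 by rewrite gt_eqF //; lra.
have N0 : nR != 0 by rewrite gt_eqF.
have -> : A^-1 - (A - 1)^-1 = - (A^-1 * (A - 1)^-1).
  by field; rewrite A0 A1.
have i1 : 0 < A^-1 by rewrite invr_gt0; lra.
have i2 : 0 < (A - 1)^-1 by rewrite invr_gt0; lra.
have : A^-1 * (A - 1)^-1 * (3 / 2 * (A / nR)) <= A^-1 * (A - 1)^-1 * g.
  by rewrite ler_wpM2l // mulr_ge0 // ltW.
have -> : A^-1 * (A - 1)^-1 * (3 / 2 * (A / nR)) = 3 / 2 / nR * (A - 1)^-1.
  by field; rewrite A0 A1 N0.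
lra.
Qed.

(** As A - 1 <= n, the indicator is at most n times the potential, and n times the
    mean potential still loses a proportion of at least 1 / (4n) at each step. *)
Lemma path_mean_low_cvg0 N (e : R) : 0 < e ->
  \forall n \near \oo, path_mean n (fun x => (low_activity N n.+2 x)%:R) <= e.
Proof.
pose E n := path_mean n (low_potential N n.+2).
pose u n : R := n.+2%:R * E n.
have E0 n : 0 <= E n.
  have H0 : path_mean n (fun _ => 0 + 0 * 0) = 0.
    by have -> := path_mean_affine n 0 0 (fun _ => 0); rewrite mul0r addr0.
  rewrite -[leLHS]H0; apply: path_mean_le => x [_ _ xa].
  by rewrite mul0r addr0 /low_potential mulr_ge0 ?ler0n // invr_ge0; lra.
have uS n : (N <= n)%N -> u n.+1 <= u n - (u n / 4) / n.+1%:R.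
  move=> Nn.
  have ES : E n.+1 <= (1 - 3 / 2 / n.+2%:R) * E n.
    rewrite /E /= -[leRHS]add0r -path_mean_affine; apply: path_mean_le => x xp.
    by rewrite add0r; apply: low_potential_contract => //; rewrite !leqW.
  have n1 : (0 : R) < n.+1%:R by rewrite ltr0n.
  rewrite /u -[n.+3%:R]natr1 -[n.+2%:R]natr1 in ES *.
  have z1 : (1 : R) <= n.+1%:R by rewrite ler1n.
  move: (n.+1%:R) n1 z1 ES (E0 n) => z z0 z1 ES E0n.
  apply: (@le_trans _ _ ((z + 1 + 1) * ((1 - 3 / 2 / (z + 1)) * E n))).
    by rewrite ler_wpM2l //; lra.
  rewrite -subr_ge0.
  have -> : (z + 1) * E n - (z + 1) * E n / 4 / z
      - (z + 1 + 1) * ((1 - 3 / 2 / (z + 1)) * E n)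
      = E n * (z ^+ 2 + 6 * z - 1) / (4 * z * (z + 1)).
    have zz : z + 1 != 0 by rewrite gt_eqF //; lra.
    by field; rewrite zz gt_eqF.
  by rewrite divr_ge0 ?mulr_ge0 //; nra.
have low_le n : path_mean n (fun x => (low_activity N n.+2 x)%:R) <= u n.
  rewrite /u /E -[leRHS]add0r -path_mean_affine; apply: path_mean_le => x [_ _ xa].
  rewrite add0r /low_potential; case: (boolP (low_activity _ _ _)) => L; last by rewrite mul0r mulr0.
  rewrite mul1r ler_pdivlMr ?mul1r; last by lra.
  have := activity_le n.+2 x; lra.
move=> e0.
suff : \forall n \near \oo, u n <= e by apply: filterS => n; exact: le_trans.
move: e e0; apply: (@drift_limsup_le0 R _ (Num.max (u N) 1) 1) => //.
- by rewrite lt_max ltr01 orbT.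
- move=> e e0; exists (e / 4); first by rewrite divr_gt0.
  exists N => // n /= Nn /andP[en _]; apply: (le_trans (uS n Nn)).
  by rewrite lerD2l lerN2 ler_wpM2r ?invr_ge0 // ler_wpM2r ?invr_ge0.
- exists N => // n /= Nn; apply: (le_trans (uS n Nn)).
  rewrite lerD2l -mulNr ler_wpM2r ?invr_ge0 // (@le_trans _ _ 0) // oppr_le0.
  by rewrite divr_ge0 // mulr_ge0.
- move=> M; exists (N + M)%N; first exact: leq_addl.
  rewrite le_max; apply/orP; left.
  elim: M => [|M IH]; first by rewrite addn0.
  rewrite addnS; apply: le_trans (uS _ (leq_addr _ _)) _; apply: le_trans IH.
  by rewrite gerBl divr_ge0 // divr_ge0 // mulr_ge0.
Qed.

End PathExpectation.

(** * Events decoupled from a family of sources *)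

Section Decoupling.
Context d (T : measurableType d) (R : realType) (P : probability T R).
Context (X : nat -> {RV P >-> R}) (U : 'I_2 -> nat -> {RV P >-> nat})
  (sigma : 'I_2 -> nat -> {RV P >-> R}).
Context (indep :
  mutual_independence P primitive_source (source_events X U sigma)).

Let events := source_events X U sigma.

Lemma measurable_source_event s A : events s A -> measurable A.
Proof. by case: s => [n|i n|i n] [B mB <-]; rewrite setTI -[_ @^-1` _]setTI; exact: measurable_funP. Qed.

Lemma measurable_cylinder (J : {fset source}) (E : source -> set T) :
  (forall i, i \in J -> events i (E i)) -> measurable (\bigcap_(i in [set` J]) E i).
Proof.
move=> JE; apply: fin_bigcap_measurable => // i iJ.
exact: measurable_source_event (JE i iJ).
Qed.

(** For B independent of the sources in Q, this holds with c the probability of B.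
    Keeping only the inequality makes the notion stable under arbitrary finite
    unions, without disjointness or measurability of the path events covered. *)
Definition decoupled (Q : set source) (B : set T) (c : R) :=
  measurable B /\
  forall (J : {fset source}) (E : source -> set T),
    [set` J] `<=` Q -> (forall i, i \in J -> events i (E i)) ->
    (P (B `&` \bigcap_(i in [set` J]) E i) <=
     c%:E * P (\bigcap_(i in [set` J]) E i))%E.

Lemma decoupledT : decoupled primitive_source setT 1.
Proof. by split=> [|J E _ _]; [exact: measurableT | rewrite setTI mul1e]. Qed.

Lemma decoupled0 Q : decoupled Q set0 0.
Proof. by split=> [|J E _ _]; [exact: measurable0 | rewrite set0I measure0 mul0e]. Qed.

Lemma sub_decoupled Q Q' B c : Q' `<=` Q -> decoupled Q B c -> decoupled Q' B c.
Proof. by move=> QQ [mB H]; split=> // J E JQ; apply: H; exact: subset_trans QQ. Qed.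

Lemma decoupledU Q B B' c c' :
  decoupled Q B c -> decoupled Q B' c' -> decoupled Q (B `|` B') (c + c').
Proof.
move=> [mB HB] [mB' HB']; split=> [|J E JQ JE]; first exact: measurableU.
have mJ := measurable_cylinder JE.
rewrite setIUl; apply: le_trans (measureU2 _ _ _) _; try exact: measurableI.
rewrite EFinD muleDl //; last exact: fin_num_measure.
by apply: leeD; [exact: HB | exact: HB'].
Qed.

Lemma decoupled_bigU Q (I : finType) (B : I -> set T) (c : I -> R) :
  (forall i, decoupled Q (B i) (c i)) ->
  decoupled Q (\big[setU/set0]_i B i) (\sum_i c i).
Proof.
move=> H; apply: (big_ind2 (decoupled Q)) => //; first exact: decoupled0.
by move=> *; exact: decoupledU.
Qed.

(** An event of one more source s may be conjoined, after which s is spent: the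
    cylinder over J becomes one over J with s added, and independence splits off
    the factor q. *)
Lemma decoupledI Q B c s A q : P A = q%:E -> events s A ->
  Q `<=` primitive_source -> Q s -> decoupled Q B c ->
  decoupled (Q `\ s) (B `&` A) (c * q).
Proof.
move=> PA sA QP Qs [mB H]; split=> [|J E JQ JE].
  exact: measurableI (measurable_source_event sA).
pose E' i := if i == s then A else E i.
have sJ : s \notin J by apply/negP => /JQ[_ /(_ erefl)].
have JE' i : i \in (s |` J)%fset -> events i (E' i).
  by rewrite in_fset1U /E'; case: eqP => [->|_] //= /JE.
have E'J i : i \in J -> E' i = E i.
  by move=> iJ; rewrite /E'; case: eqP => // si; rewrite -si iJ in sJ.
have J'Q : [set` (s |` J)%fset] `<=` Q.
  by move=> i /=; rewrite in_fset1U => /predU1P[->//|/JQ[]].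
have capE : \bigcap_(i in [set` (s |` J)%fset]) E' i = A `&` \bigcap_(i in [set` J]) E i.
  rewrite bigcap_fsetU1 /E' eqxx; congr (_ `&` _).
  by apply: eq_bigcapr => i iJ; exact: E'J.
have probE : (P (A `&` \bigcap_(i in [set` J]) E i) = q%:E * P (\bigcap_(i in [set` J]) E i))%E.
  rewrite -capE (indep (subset_trans J'Q QP) JE').
  rewrite (indep (J := J) _ JE); last by move=> i /JQ[/QP].
  rewrite big_fsetU1 //= {1}/E' eqxx PA; congr (_ * _)%E.
  by apply: eq_big_seq => i iJ; rewrite E'J.
rewrite -setIA EFinM -muleA -probE -capE; exact: H.
Qed.

Lemma decoupled_measure_le Q B c : decoupled Q B c -> (P B <= c%:E)%E.
Proof.
move=> [_ H]; have := H fset0 (fun _ => setT).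
by rewrite set_fset0 bigcap_set0 setIT probability_setT mule1; apply => // i; rewrite inE.
Qed.

End Decoupling.

(** * The law of the walk *)

Lemma ae_setT_of_prob1 d (T : measurableType d) (R : realType)
    (P : probability T R) (A : set T) :
  measurable A -> P A = 1%E -> {ae P, forall w, A w}.
Proof.
move=> mA PA; exists (~` A); split=> //; first exact: measurableC.
by rewrite probability_setC // PA subee.
Qed.

Lemma ae_cover d (T : measurableType d) (R : realType) (P : probability T R)
    (F : nat -> set T) n :
  (forall k, measurable (F k)) -> trivIset setT F ->
  (\sum_(k < n) P (F k) = 1)%E ->
  {ae P, forall w, exists2 k, (k < n)%N & F k w}.
Proof.
move=> mF tF PF.
have mU : measurable (\big[setU/set0]_(k < n) F k).
  by apply: bigsetU_measurable => k _.
have := ae_setT_of_prob1 (P := P) mU; rewrite measure_bigsetU // => /(_ PF).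
apply: filterS => w; rewrite -bigcup_mkord => -[k /= kn Fk].
by exists k.
Qed.

Section Walk.
Context d (T : measurableType d) (R : realType) (P : probability T R).
Context (p : R) (X : nat -> {RV P >-> R}) (U : 'I_2 -> nat -> {RV P >-> nat})
  (sigma : 'I_2 -> nat -> {RV P >-> R}).
Context (walk : elephant_walk p X U sigma).

(** The laws of the sources fix their values only up to null sets, on which a
    recalled index could even point to a future step. *)
Definition sources_in_range (w : T) : Prop :=
  [/\ forall n, (1 <= n <= 2)%N -> exists s, X n w = sign_of R s,
      forall i n, (2 <= n)%N -> exists2 k, (k < n)%N & U i n.+1 w = k.+1
    & forall i n, (2 <= n)%N -> exists s, sigma i n.+1 w = sign_of R s].

Lemma measurable_value (Y : {RV P >-> R}) (v : R) : measurable [set w | Y w = v].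
Proof.
have -> : [set w | Y w = v] = Y @^-1` [set v] by [].
by rewrite -[_ @^-1` _]setTI; apply: measurable_funP => //; exact: measurable_set1.
Qed.

Lemma measurable_nat_value (Y : {RV P >-> nat}) (v : nat) : measurable [set w | Y w = v].
Proof.
have -> : [set w | Y w = v] = Y @^-1` [set v] by [].
by rewrite -[_ @^-1` _]setTI; exact: measurable_funP.
Qed.

Lemma sign_of_inj : injective (sign_of R).
Proof.
have H : (1 : R) != -1 by rewrite -subr_eq0 opprK (_ : 1 + 1 = 2%:R) // pnatr_eq0.
by case=> -[] //= /eqP; rewrite ?(negbTE H) // eq_sym (negbTE H).
Qed.

Lemma ae_sign (Y : {RV P >-> R}) (a b : R) : a + b = 1 ->
  P [set w | Y w = 1] = a%:E -> P [set w | Y w = -1] = b%:E ->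
  {ae P, forall w, exists s, Y w = sign_of R s}.
Proof.
move=> ab Pa Pb.
pose F k := [set w | (k < 2)%N /\ Y w = sign_of R (k == 0)%N].
have FE k : (k < 2)%N -> F k = [set w | Y w = sign_of R (k == 0)%N].
  by move=> k2; apply/seteqP; split=> w /=; [case|].
have : {ae P, forall w, exists2 k, (k < 2)%N & F k w}.
  apply: ae_cover.
  - move=> k; have [k2|k2] := ltnP k 2; first by rewrite FE //; exact: measurable_value.
    rewrite (_ : F k = set0); first exact: measurable0.
    by rewrite /F ltnNge k2; apply/seteqP; split=> w // -[].
  - move=> k l _ _ [w [[k2 +] [l2 +]]] => -> /sign_of_inj.
    by case: k k2 => [|[|]]; case: l l2 => [|[|]].
  - by rewrite !big_ord_recl big_ord0 adde0 /= !FE //= Pa Pb -EFinD ab.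
by apply: filterS => w [k _ [_ ->]]; exists (k == 0).
Qed.

Lemma ae_sources_in_range : {ae P, forall w, sources_in_range w}.
Proof.
have HX : {ae P, forall w, forall n, (1 <= n <= 2)%N -> exists s, X n w = sign_of R s}.
  apply: ae_foralln => n; have [n12|n12] := boolP (1 <= n <= 2)%N; last first.
    by apply: aeW.
  have [P1 P2] := first_steps_law walk n12.
  have : (2^-1 + 2^-1 : R) = 1 by field.
  by move=> /ae_sign /(_ P1 P2); apply: filterS.
have HU i : {ae P, forall w, forall n, (2 <= n)%N -> exists2 k, (k < n)%N & U i n.+1 w = k.+1}.
  apply: ae_foralln => n; have [n2|n2] := leqP 2 n; last by apply: aeW.
  have : {ae P, forall w, exists2 k, (k < n)%N & [set w | U i n.+1 w = k.+1] w}.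
    apply: ae_cover.
    - by move=> k; exact: measurable_nat_value.
    - by move=> k l _ _ [w [/= -> [->]]].
    - rewrite (eq_bigr (fun _ => (n%:R^-1)%:E)); last first.
        by move=> k _; apply: (index_law walk i n2); rewrite ltn_ord.
      rewrite sumEFin sumr_const card_ord -(mulr_natl n%:R^-1) mulfV //.
      by rewrite pnatr_eq0 -lt0n (leq_trans _ n2).
  by apply: filterS.
have HS i : {ae P, forall w, forall n, (2 <= n)%N -> exists s, sigma i n.+1 w = sign_of R s}.
  apply: ae_foralln => n; have [n2|n2] := leqP 2 n; last by apply: aeW.
  have [P1 P2] := sign_law walk i n2.
  have : p + (1 - p) = 1 by ring.
  by move=> /ae_sign /(_ P1 P2); apply: filterS.
have H2 (Q : 'I_2 -> T -> Prop) : (forall i, {ae P, forall w, Q i w}) -> {ae P, forall w, forall i, Q i w}.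
  move=> HQ; apply: filterS2 (HQ ord0) (HQ (lift ord0 ord0)) => w q0 q1 i; case: i => -[|[|//]] i2.
    by rewrite (_ : Ordinal i2 = ord0) //; exact: val_inj.
  by rewrite (_ : Ordinal i2 = lift ord0 ord0) //; exact: val_inj.
by apply: filterS3 HX (H2 _ HU) (H2 _ HS) => w; split.
Qed.

End Walk.

Definition sources_after (n : nat) : set source :=
  [set s | match s with
           | SrcStep _ => False
           | SrcIndex _ k | SrcSign _ k => (n < k)%N
           end].

Section Walk.
Context d (T : measurableType d) (R : realType) (P : probability T R).
Context (p : R) (X : nat -> {RV P >-> R}) (U : 'I_2 -> nat -> {RV P >-> nat})
  (sigma : 'I_2 -> nat -> {RV P >-> R}).
Context (p_ge0 : 0 <= p).
Context (p_le1 : p <= 1).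
Context (walk : elephant_walk p X U sigma).

Definition walk_path n (w : T) : seq R := mkseq (fun j => X j.+1 w) n.

Let indep := sources_independent walk.

Lemma sources_after_primitive n : (2 <= n)%N -> sources_after n `<=` primitive_source.
Proof. by move=> n2 [k|i k|i k] //= nk; exact: leq_trans nk. Qed.

Let events_value n (v : R) : source_events X U sigma (SrcStep n) [set w | X n w = v].
Proof. by exists [set v]; [exact: measurable_set1 | rewrite setTI]. Qed.

Let events_sign i n (v : R) : source_events X U sigma (SrcSign i n) [set w | sigma i n w = v].
Proof. by exists [set v]; [exact: measurable_set1 | rewrite setTI]. Qed.

Let events_index i n (v : nat) : source_events X U sigma (SrcIndex i n) [set w | U i n w = v].
Proof. by exists [set v] => //; rewrite setTI. Qed.

Lemma first_step_prob n s : (1 <= n <= 2)%N -> P [set w | X n w = sign_of R s] = (2^-1)%:E.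
Proof. by move=> n12; have [? ?] := first_steps_law walk n12; case: s. Qed.

Lemma sign_prob i n s : (2 <= n)%N ->
  P [set w | sigma i n.+1 w = sign_of R s] = (sign_weight p s)%:E.
Proof. by move=> n2; have [? ?] := sign_law walk i n2; case: s. Qed.

Lemma decoupled_channel n i (c : channel n) Q B q : (2 <= n)%N ->
  Q `<=` primitive_source -> Q (SrcIndex i n.+1) -> Q (SrcSign i n.+1) ->
  decoupled X U sigma Q B q ->
  decoupled X U sigma (Q `\ SrcIndex i n.+1 `\ SrcSign i n.+1)
    (B `&` [set w | U i n.+1 w = (c.1).+1] `&` [set w | sigma i n.+1 w = sign_of R c.2])
    (q * channel_weight p c).
Proof.
move=> n2 QP Q1 Q2 BQ; rewrite /channel_weight mulrA.
apply: (decoupledI indep (sign_prob _ _ _)) => //.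
  by move=> s [/QP].
apply: (decoupledI indep (index_law walk i n2 _)) => //.
by rewrite ltn_ord.
Qed.

Lemma walk_step n (w : T) (c : draw n) : (2 <= n)%N ->
  U ord0 n.+1 w = (c.1.1).+1 -> sigma ord0 n.+1 w = sign_of R c.1.2 ->
  U (lift ord0 ord0) n.+1 w = (c.2.1).+1 ->
  sigma (lift ord0 ord0) n.+1 w = sign_of R c.2.2 ->
  walk_path n.+1 w = rcons (walk_path n w) (new_step (walk_path n w) c).
Proof.
move=> n2 U0 s0 U1 s1; rewrite /walk_path mkseqS; congr rcons.
rewrite (step_recursion walk) // !big_ord_recl big_ord0 addr0.
by rewrite /recalled_step U0 s0 U1 s1 /new_step /recalled !nth_mkseq.
Qed.

(** The averages [path_mean] bound the law of the walk.  A path of length n + 3 is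
    a path of length n + 2 with a draw, so the event D is covered by the union
    over draws c of the events that the draw is c and that the shorter path,
    extended by c, satisfies D; the four sources at time n + 3 are spent one by
    one.  Here D is an arbitrary predicate, and the covering event carries the
    measurability. *)
Lemma path_event_decoupled n (D : seq R -> bool) : exists2 B,
  decoupled X U sigma (sources_after n.+2) B (path_mean p n (fun x => (D x)%:R)) &
  forall w, sources_in_range X U sigma w -> D (walk_path n.+2 w) -> B w.
Proof.
elim: n D => [|n IH] D.
  exists (\big[setU/set0]_(s : bool * bool)
    if D [:: sign_of R s.1; sign_of R s.2] then
      setT `&` [set w | X 1%N w = sign_of R s.1] `&` [set w | X 2%N w = sign_of R s.2]
    else set0); last first.
    move=> w [HX _ _]; have [s1 X1] := HX 1%N isT; have [s2 X2] := HX 2%N isT.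
    rewrite /walk_path /mkseq /= X1 X2 => Ds.
    by rewrite (bigD1 (s1, s2)) //= Ds; left.
  apply: decoupled_bigU => s; case: ifP => _; last first.
    by rewrite mulr0; exact: decoupled0.
  rewrite mulr1.
  apply: (sub_decoupled (Q := primitive_source `\ SrcStep 1%N `\ SrcStep 2%N)).
    by move=> [k|i k|i k] //= k2; do !split=> //.
  rewrite (_ : 4^-1 = 1 * 2^-1 * 2^-1); last by field.
  apply: (decoupledI indep (first_step_prob _ _)) => //.
  apply: (decoupledI indep (first_step_prob _ _)) => //; exact: decoupledT.
have n2 : (2 <= n.+2)%N by [].
have /choice[B BP] : forall c : draw n.+2, exists B,
    decoupled X U sigma (sources_after n.+2) B
      (path_mean p n (fun x => (D (rcons x (new_step x c)))%:R)) /\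
    forall w, sources_in_range X U sigma w ->
      D (rcons (walk_path n.+2 w) (new_step (walk_path n.+2 w) c)) -> B w.
  by move=> c; have [B H1 H2] := IH (fun x => D (rcons x (new_step x c))); exists B.
pose B' (c : draw n.+2) := B c
  `&` [set w | U ord0 n.+3 w = (c.1.1).+1] `&` [set w | sigma ord0 n.+3 w = sign_of R c.1.2]
  `&` [set w | U (lift ord0 ord0) n.+3 w = (c.2.1).+1]
  `&` [set w | sigma (lift ord0 ord0) n.+3 w = sign_of R c.2.2].
exists (\big[setU/set0]_c B' c).
  rewrite /= (_ : path_mean _ _ _ = \sum_(c : draw n.+2)
      draw_weight p c * path_mean p n (fun x => (D (rcons x (new_step x c)))%:R)); last first.
    by rewrite -path_mean_sum.
  apply: decoupled_bigU => c; rewrite mulrC /draw_weight mulrA.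
  have S := sources_after_primitive n2.
  have H := decoupled_channel (i := lift ord0 ord0) c.2 n2 _ _ _ (decoupled_channel (i := ord0) c.1 n2 S _ _ (BP c).1).
  apply: sub_decoupled (H _ _ _ _ _) => //.
  - move=> s sn.
    have ne i : s <> SrcIndex i n.+3 /\ s <> SrcSign i n.+3.
      by split=> E; rewrite E /= ltnn in sn.
    have sn2 : sources_after n.+2 s by case: s sn {ne} => //= i k; exact: ltnW.
    by split; [split; [split; [split|]|]|] => //; have [] := ne ord0; have [] := ne (lift ord0 ord0).
  - by move=> t [[/S]].
  - by split; [split; [rewrite /= ltnSn|]|].
  - by split; [split; [rewrite /= ltnSn|]|].
  - exact: ltnSn.
  - exact: ltnSn.
move=> w wr; have [_ HU HS] := wr => Dw.
have [k0 k0n U0] := HU ord0 _ n2; have [k1 k1n U1] := HU (lift ord0 ord0) _ n2.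
have [s0 S0] := HS ord0 _ n2; have [s1 S1] := HS (lift ord0 ord0) _ n2.
pose c : draw n.+2 := ((Ordinal k0n, s0), (Ordinal k1n, s1)).
rewrite (bigD1 c) //=; left; do ![split=> //].
by apply: (BP c).2 => //; rewrite -(walk_step (c := c) n2 U0 S0 U1 S1).
Qed.

Lemma path_event_le n (D : seq R -> bool) : exists B, [/\ measurable B,
  (P B <= (path_mean p n (fun x => (D x)%:R))%:E)%E &
  forall w, sources_in_range X U sigma w -> D (walk_path n.+2 w) -> B w].
Proof.
have [B BD HB] := path_event_decoupled n D.
by exists B; split=> //; [case: BD | exact: decoupled_measure_le BD].
Qed.

Lemma path_mean_noise_tail (g : R -> R) n (K : R) : 0 < K ->
  (forall e, possible_step e -> `|g e| <= 1) ->
  path_mean p n (fun x => (K < `|noise p g n.+2 x|)%R%:R) <= n%:R / K ^+ 2.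
Proof.
move=> K0 g1.
apply: (@le_trans _ _ (path_mean p n (fun x => 0 + (K ^+ 2)^-1 * noise p g n.+2 x ^+ 2))).
  apply: (path_mean_le p_ge0 p_le1) => x _; rewrite add0r.
  have K2 : 0 < K ^+ 2 by rewrite exprn_gt0.
  case: ltP => Kx; last by rewrite mulr_ge0 ?invr_ge0 ?sqr_ge0 // ltW.
  rewrite mulrC ler_pdivlMr // mul1r -[leRHS]real_normK ?num_real //.
  by rewrite lerXn2r ?nnegrE // ltW.
rewrite (path_mean_affine p_ge0 p_le1) add0r mulrC ler_wpM2r ?invr_ge0 ?sqr_ge0 //.
exact: path_mean_noise.
Qed.

(** Along n = k^4 the Chebyshev bound at level k^3 is k^4 / k^6, which is
    summable. *)
Lemma ae_noise_le (g : R -> R) : (forall e, possible_step e -> `|g e| <= 1) ->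
  {ae P, forall w, exists K, forall k, (K <= k)%N ->
    `|noise p g (k ^ 4)%N (walk_path (k ^ 4)%N w)| <= (k ^ 3)%N%:R}.
Proof.
move=> g1.
pose N k := (k.+2 ^ 4 - 2)%N.
have NE k : (N k).+2 = (k.+2 ^ 4)%N.
  by rewrite -addn2 subnK // (@leq_trans (2 ^ 4)) // leq_exp2r.
have /choice[F HF] k := path_event_le (N k)
  (fun x => (k.+2 ^ 3)%N%:R < `|noise p g (N k).+2 x|).
have mF k : measurable (F k) by have [] := HF k.
(* 1 / (k + 2)^2 is replaced by a larger telescoping term. *)
have PF k : (P (F k) <= ((k.+1%:R * k.+2%:R)^-1)%:E)%E.
  have [_ H _] := HF k; apply: (le_trans H); rewrite lee_fin.
  apply: (le_trans (path_mean_noise_tail _ _ g1)); first by rewrite ltr0n expn_gt0.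
  have k1 : (0 : R) < k.+1%:R by rewrite ltr0n.
  have k2 : (0 : R) < k.+2%:R by rewrite ltr0n.
  apply: (@le_trans _ _ ((k.+2 ^ 4)%N%:R / (k.+2 ^ 3)%N%:R ^+ 2)).
    by rewrite ler_wpM2r ?invr_ge0 ?sqr_ge0 // ler_nat leq_subr.
  rewrite !natrX (_ : _ / _ = (k.+2%:R * k.+2%:R)^-1); last by field; rewrite gt_eqF.
  rewrite lef_pV2 ?posrE ?mulr_gt0 // ler_wpM2r ?ltW //.
  by rewrite ltr_nat.
have sumF : (\sum_(0 <= k <oo) P (F k) < +oo)%E.
  apply: (@le_lt_trans _ _ 1%E); last exact: ltry.
  apply: lime_le; first by apply: is_cvg_nneseries.
  apply: nearW => m.
  apply: (@le_trans _ _ (\sum_(0 <= k < m) ((k.+1%:R * k.+2%:R)^-1)%:E)%E).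
    by apply: lee_sum => k _.
  rewrite sumEFin lee_fin.
  rewrite (_ : \sum_(0 <= k < m) (k.+1%:R * k.+2%:R)^-1 = 1 - m.+1%:R^-1 :> R).
    by rewrite gerBl invr_ge0.
  elim: m => [|m IH]; first by rewrite big_geq // invr1 subrr.
  rewrite big_nat_recr //= IH.
  have k1 : (0 : R) < m.+1%:R by rewrite ltr0n.
  rewrite -[m.+2%:R]natr1; move: (m.+1%:R) k1 => z z0.
  have zz : z + 1 != 0 by rewrite gt_eqF // addr_gt0.
  by field; rewrite zz gt_eqF.
have lim0 := lim_sup_set_cvg0 mF sumF.
have mlim : measurable (lim_sup_set F).
  by apply: bigcap_measurableType => n _; exact: bigcup_measurable.
have aelim : {ae P, forall w, ~ lim_sup_set F w}.
  by exists (lim_sup_set F); split=> // w /= /contrapT.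
apply: filterS2 (ae_sources_in_range walk) aelim => w wr.
rewrite /lim_sup_set => /existsNP[K /not_implyP[_ HK]].
exists K.+2 => -[|[|k]] // Kk.
rewrite leNgt; apply/negP => kn; apply: HK; exists k => //.
by have [_ _] := HF k; apply; rewrite // NE.
Qed.

(** For each N, staying below activity n / 3 from time N on is contained in
    events of arbitrarily small probability by [path_mean_low_cvg0]. *)
Lemma ae_activity_recurrent : {ae P, forall w N, exists2 n, (N <= n)%N &
  n%:R / 3 <= activity n (walk_path n w)}.
Proof.
apply: ae_foralln => N.
have /choice[B HB] n := path_event_le n (low_activity N n.+2).
pose F := \bigcap_n B n.
have mF : measurable F by apply: bigcap_measurableType => n _; have [] := HB n.
have PF : P F = 0%E.
  apply/eqP; rewrite eq_le measure_ge0 andbT.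
  apply/lee_addgt0Pr => e e0; rewrite add0e.
  have [n _ Hn] := path_mean_low_cvg0 p_ge0 p_le1 N e0.
  have [mB PB _] := HB n.
  apply: (@le_trans _ _ (P (B n))).
    by apply: le_measure; rewrite ?inE //; exact: bigcap_inf.
  by apply: le_trans PB _; rewrite lee_fin; apply: Hn => /=.
have aeF : {ae P, forall w, ~ F w}.
  by exists F; split=> // w /= /contrapT.
apply: filterS2 (ae_sources_in_range walk) aeF => w wr Fw.
apply: contrapT => H; apply: Fw => n _.
have [_ _] := HB n; apply=> //; apply/allP => k; rewrite mem_index_iota => /andP[Nk kn].
rewrite ltNge; apply/negP => kA; apply: H; exists k => //; apply: le_trans kA _.
rewrite le_eqVlt; apply/orP; left; apply/eqP.
apply: eq_big_nat => j /andP[_ jk].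
by rewrite !nth_mkseq // (leq_trans jk).
Qed.

End Walk.

(** * Almost sure convergence *)

Lemma fourth_root (n : nat) : exists k, (k ^ 4 <= n < k.+1 ^ 4)%N.
Proof.
elim: n => [|n [k /andP[kn nk]]]; first by exists 0%N.
have [nk1|nk1] := ltnP n.+1 (k.+1 ^ 4); first by exists k; rewrite (leqW kn).
by exists k.+1; rewrite nk1 /=; apply: leq_ltn_trans nk _; rewrite ltn_exp2r.
Qed.

(** The gap from k^4 to (k + 1)^4 is at most 15 k^3, so the control at fourth powers
    extends to all n with an error of order k^3 <= n / k. *)
Lemma sublinear_of_fourth_powers (R : realType) (v : nat -> R) (c : R) (n0 K : nat) :
  0 <= c -> (forall n, (n0 <= n)%N -> `|v n.+1 - v n| <= c) ->
  (forall k, (K <= k)%N -> `|v (k ^ 4)%N| <= (k ^ 3)%N%:R) ->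
  v n / n%:R @[n --> \oo] --> (0 : R).
Proof.
move=> c0 step Hk.
have grow n m : (n0 <= n)%N -> `|v (n + m)%N| <= `|v n| + c * m%:R.
  move=> n0n; elim: m => [|m IH]; first by rewrite addn0 mulr0 addr0.
  rewrite addnS -[v _](subrK (v (n + m)%N)) (le_trans (ler_normD _ _)) //.
  rewrite addrC -natr1 mulrDr mulr1 addrA lerD // step //.
  by rewrite (leq_trans n0n) // leq_addr.
apply/cvgr0Pnorm_le => e e0.
pose K1 := (K + n0 + 1 + (Num.truncn ((1 + 15 * c) / e)).+1)%N.
have K1e : 1 + 15 * c <= e * K1%:R.
  rewrite [leRHS]mulrC -ler_pdivrMr //; have h := truncnS_gt ((1 + 15 * c) / e); apply: (le_trans (ltW h)).
  by rewrite ler_nat leq_addl.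
exists (K1 ^ 4)%N => // n /= K1n.
have [k /andP[kn nk]] := fourth_root n.
have K1k : (K1 <= k)%N by rewrite -ltnS -(ltn_exp2r _ _ (e := 4)) // (leq_ltn_trans K1n).
have k1 : (1 <= k)%N by apply: leq_trans K1k; rewrite /K1; lia.
have n_gt0 : (0 : R) < n%:R by rewrite ltr0n (leq_trans _ kn) // expn_gt0 k1.
rewrite normrM normfV (gtr0_norm n_gt0) ler_pdivrMr //.
have kk : (k <= k ^ 4)%N by rewrite -{1}(expn1 k) leq_pexp2l.
have gap : (n - k ^ 4 <= 15 * k ^ 3)%N by move: nk; nia.
have := grow (k ^ 4)%N (n - k ^ 4)%N; rewrite subnKC // => /(_ ltac:(rewrite /K1 in K1k; lia)) vn.
have vk := Hk k ltac:(rewrite /K1 in K1k; lia).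
have k3 : (0 : R) <= (k ^ 3)%N%:R by [].
have gapR : (n - k ^ 4)%N%:R <= 15 * (k ^ 3)%N%:R :> R by rewrite -natrM ler_nat.
apply: (@le_trans _ _ ((1 + 15 * c) * (k ^ 3)%N%:R)).
  apply: (le_trans vn); rewrite mulrDl mul1r lerD //.
  by rewrite [15 * c]mulrC -mulrA ler_wpM2l.
apply: (@le_trans _ _ (e * K1%:R * (k ^ 3)%N%:R)); first by rewrite ler_wpM2r.
rewrite -mulrA ler_wpM2l ?(ltW e0) // -natrM ler_nat (leq_trans _ kn) //.
by rewrite [(k ^ 4)%N]expnS leq_mul2r K1k orbT.
Qed.

Section Assembly.
Context d (T : measurableType d) (R : realType) (P : probability T R).
Context (p : R) (X : nat -> {RV P >-> R}) (U : 'I_2 -> nat -> {RV P >-> nat})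
  (sigma : 'I_2 -> nat -> {RV P >-> R}).
Context (walk : elephant_walk p X U sigma).
Context (w : T).
Context (range_w : sources_in_range X U sigma w).

Lemma possible_walk_step n : possible_step (X n.+1 w).
Proof.
have [HX _ _] := range_w; case: n => [|[|n]].
- by have [s ->] := HX 1%N isT; exact: possible_sign.
- by have [s ->] := HX 2%N isT; exact: possible_sign.
- rewrite (step_recursion walk) // /possible_step.
  by case: sgrP; rewrite eqxx ?orbT.
Qed.

Lemma possible_walk_path n : all (@possible_step R) (walk_path X n w).
Proof. by apply/allP => _ /mapP[j _ ->]; exact: possible_walk_step. Qed.

Lemma displacement_walk_path n :
  displacement n (walk_path X n w) = position X n w.
Proof.
rewrite /displacement /position big_add1 /=.
by apply: eq_big_nat => j /andP[_ jn]; rewrite nth_mkseq.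
Qed.

Lemma activity_walk_path n :
  activity n (walk_path X n w) = (nonzero_steps X n w)%:R.
Proof.
rewrite /activity /nonzero_steps big_add1 natr_sum /=.
by apply: eq_big_nat => j /andP[_ jn]; rewrite nth_mkseq.
Qed.

Lemma position_le_nonzero n : `|position X n w| <= (nonzero_steps X n w)%:R.
Proof.
rewrite /position /nonzero_steps !big_add1 natr_sum.
apply: (le_trans (ler_norm_sum _ _ _)); apply: ler_sum => j _.
by case/or3P: (possible_walk_step j) => /eqP ->;
  rewrite ?oppr_eq0 ?oner_eq0 ?eqxx ?normrN ?normr1 ?normr0.
Qed.

Definition walk_noise (g : R -> R) n := noise p g n (walk_path X n w).

Lemma walk_noiseS g n : (2 <= n)%N -> walk_noise g n.+1 =
  walk_noise g n + (g (X n.+1 w) - next_mean p n g (walk_path X n w)).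
Proof.
by move=> n2; rewrite /walk_noise /walk_path mkseqS noise_rcons // size_mkseq.
Qed.

End Assembly.

Lemma normalized_step (R : realType) (q : nat -> R) (mu : R) (n : nat) :
  (0 < n)%N -> q n.+1 = q n + mu ->
  q n.+1 / n.+1%:R = q n / n%:R + (mu - q n / n%:R) / n.+1%:R.
Proof.
move=> n0 ->; rewrite -natr1.
have z0 : (0 : R) < n%:R by rewrite ltr0n.
move: (n%:R) z0 => z z0.
have zz : z + 1 != 0 by rewrite gt_eqF // addr_gt0.
by field; rewrite zz gt_eqF.
Qed.

Theorem theorem1p3 (d : measure_display) (T : measurableType d) (R : realType)
    (P : probability T R) (p : R) (X : nat -> {RV P >-> R})
    (U : 'I_2 -> nat -> {RV P >-> nat}) (sigma : 'I_2 -> nat -> {RV P >-> R})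
    (p_gt0 : 0 < p) (p_le : p <= 7 / 8)
    (walk : elephant_walk p X U sigma) :
  {ae P, forall w,
    (position X n w / n%:R @[n --> \oo] --> (0 : R)) /\
    ((nonzero_steps X n w)%:R / n%:R @[n --> \oo] --> (2 / 3 : R))}.
Proof.
have p_ge0 : 0 <= p by exact: ltW.
have p_le1 : p <= 1 by apply: le_trans p_le _; lra.
have id_le (e : R) : possible_step e -> `|id e| <= 1.
  by case/or3P => /eqP ->; rewrite ?normrN ?normr1 ?normr0.
have nz_le (e : R) : possible_step e -> `|nonzero e| <= 1.
  by rewrite /nonzero; case: (_ == 0); rewrite ?normr1 ?normr0.
have ae_noise : {ae P, forall w,
    (exists K, forall k, (K <= k)%N ->
       `|walk_noise p X w id (k ^ 4)%N| <= (k ^ 3)%N%:R) /\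
    (exists K, forall k, (K <= k)%N ->
       `|walk_noise p X w (@nonzero R) (k ^ 4)%N| <= (k ^ 3)%N%:R)}.
  apply: filterS2 (ae_noise_le p_ge0 p_le1 walk id_le)
    (ae_noise_le p_ge0 p_le1 walk nz_le) => w; exact: conj.
apply: filterS3 (ae_sources_in_range walk) ae_noise
  (ae_activity_recurrent p_ge0 p_le1 walk) => w wr [noise_id noise_nz] Hrec.
have Wp := possible_walk_path walk wr.
have noise0 g : (forall e, possible_step e -> `|g e| <= 1) ->
    (exists K, forall k, (K <= k)%N -> `|walk_noise p X w g (k ^ 4)%N| <= (k ^ 3)%N%:R) ->
    walk_noise p X w g n / n%:R @[n --> \oo] --> (0 : R).
  move=> g1 [K HK]; apply: (@sublinear_of_fourth_powers R _ 2 2 K) => // n n2.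
  rewrite walk_noiseS // addrAC subrr add0r.
  apply: (le_trans (normD_le (g1 _ (possible_walk_step walk wr n)) (_ : _ <= 1))); last by lra.
  by rewrite normrN (next_mean_norm_le p_ge0 p_le1) // ltnW.
have m_ge : -1 <= 2 * p - 1 by lra.
have m_le : 2 * p - 1 <= 3 / 4 by lra.
pose x n := position X n w / n%:R.
pose a n : R := (nonzero_steps X n w)%:R / n%:R.
(* Removing the noise from the numerators makes the recursions exact. *)
pose y n := (position X n w - walk_noise p X w id n) / n%:R.
pose b n := ((nonzero_steps X n w)%:R - walk_noise p X w (@nonzero R) n) / n%:R.
have x_le n : `|x n| <= a n.
  by rewrite /x /a normrM normfV normr_nat ler_wpM2r ?invr_ge0 // (position_le_nonzero walk wr).
have a_le n : a n <= 1.
  rewrite /a; case: n => [|n]; first by rewrite invr0 mulr0.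
  by rewrite ler_pdivrMr ?ltr0n // mul1r -activity_walk_path activity_le.
have yS : \forall n \near \oo,
    y n.+1 = y n + (mean_step (2 * p - 1) (x n) (a n) - y n) / n.+1%:R.
  exists 2%N => // n /= n2; apply: (@normalized_step R (fun n => position X n w - walk_noise p X w id n));
    first exact: ltnW.
  rewrite walk_noiseS // next_mean_id ?(ltnW n2) //.
  rewrite displacement_walk_path activity_walk_path /x /a.
  by rewrite {1}/position big_nat_recr //= -/(position X n w); ring.
have bS : \forall n \near \oo,
    b n.+1 = b n + (mean_nonzero (2 * p - 1) (x n) (a n) - b n) / n.+1%:R.
  exists 2%N => // n /= n2; apply: (@normalized_step R (fun n => (nonzero_steps X n w)%:R - walk_noise p X w (@nonzero R) n));
    first exact: ltnW.
  rewrite walk_noiseS // next_mean_nonzero ?(ltnW n2) //.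
  rewrite displacement_walk_path activity_walk_path /x /a.
  rewrite {1}/nonzero_steps big_nat_recr //= -/(nonzero_steps X n w) natrD.
  by rewrite /nonzero; ring.
have yx : y n - x n @[n --> \oo] --> (0 : R).
  rewrite (_ : (fun n => y n - x n) = (fun n => - (walk_noise p X w id n / n%:R))).
    by rewrite -oppr0; exact: (cvgN (noise0 _ id_le noise_id)).
  by apply/funext => n; rewrite /y /x; ring.
have ba : b n - a n @[n --> \oo] --> (0 : R).
  rewrite (_ : (fun n => b n - a n) = (fun n => - (walk_noise p X w (@nonzero R) n / n%:R))).
    by rewrite -oppr0; exact: (cvgN (noise0 _ nz_le noise_nz)).
  by apply/funext => n; rewrite /b /a; ring.
have rec N : exists2 n, (N <= n)%N & 1 / 3 <= a n.
  have [n nN] := Hrec N.+1; rewrite activity_walk_path => An.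
  exists n; first exact: ltnW.
  rewrite /a ler_pdivlMr ?ltr0n; last exact: leq_trans nN.
  by rewrite mulrC mulrA mulr1.
split.
- exact: (step_fraction_cvg0 m_ge m_le x_le a_le yS bS yx ba rec).
- exact: (nonzero_fraction_cvg m_ge m_le x_le a_le yS bS yx ba rec).
Qed.
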